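(* Let $\alpha\ge1$, $F_t\in\mathbb A_t^{[\alpha]}\langle\langle z\rangle\rangle$, and let $d(t),h(t)\in\mathcal D^{[\alpha]}\langle\langle z\rangle\rangle[[t]]$ be the associated operators. Then $$d(t)=\sum_{r\ge1}\int_0^t dt_1\int_0^{t_1}dt_2\cdots\int_0^{t_{r-1}}dt_r\ \sum_{\sigma\in\mathbf S_r}\frac{(-1)^{d(\sigma)}}{r}\binom{r-1}{d(\sigma)}^{-1}h(t_{\sigma(r)})\cdots h(t_{\sigma(1)}),$$ where $\mathbf S_r$ is the symmetric group of degree $r$ and, for $\sigma\in\mathbf S_r$, $d(\sigma)$ is the number of descents of $\sigma$.
   Context: $K$ is a unital commutative $\mathbb Q$-algebra, $z=(z_1,\dots,z_n)$ are commutative or noncommutative free variables, and $t$ is a formal parameter commuting with $z$ and $K$. $K\langle\langle z\rangle\rangle$ and $K[[t]]\langle\langle z\rangle\rangle$ are the formal power series algebras in $z$ over $K$ and $K[[t]]$ (in either the commutative or the noncommutative case); $o(\cdot)$ is the order in $z$. For a vector $\vec u=(u_1,\dots,u_n)$ of power series, $[\vec u\frac{\partial}{\partial z}]$ is the derivation sending $z_i$ to $u_i$. For $\alpha\ge1$, $\mathbb A_t^{[\alpha]}\langle\langle z\rangle\rangle$ is the set of automorphisms $F_t(z)=z-H_t(z)$ of $K[[t]]\langle\langle z\rangle\rangle$ over $K[[t]]$ with $o(H_t(z))\ge\alpha$ and $H_{t=0}(z)=0$. For such $F_t$ write the inverse map as $G_t(z)=F_t^{-1}(z)=z+M_t(z)$.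 Let $\mathcal D^{[\alpha]}\langle\langle z\rangle\rangle$ be the unital algebra generated by $K$-derivations of $K\langle\langle z\rangle\rangle$ that increase the degree in $z$ by at least $\alpha-1$. There is a unique $d(t)\in\mathcal D^{[\alpha]}\langle\langle z\rangle\rangle[[t]]$ with $d(0)=0$ such that $e^{d(t)}u_t(z)=u_t(G_t)$ for all $u_t(z)\in K[[t]]\langle\langle z\rangle\rangle$. Put $h(t)=[\frac{\partial M_t}{\partial t}(F_t)\frac{\partial}{\partial z}]$. Products of operators are compositions, $h(t_j)$ denotes $h(t)$ with $t$ replaced by the central parameter $t_j$, and integrals are taken formally, coefficientwise in the parameters. A descent of $\sigma$ is an index $i$ with $1\le i\le r-1$ and $\sigma(i)>\sigma(i+1)$. *)

(* Defs.v *)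
From HB Require Import structures.
From mathcomp Require Import all_boot all_order all_algebra all_fingroup.
From mathcomp Require Import boolp finmap.
From mathcomp Require Import monalg.

Set Implicit Arguments.
Unset Strict Implicit.
Unset Printing Implicit Defensive.

Import GRing.Theory.
Local Open Scope ring_scope.

(* Monomials having finitely many factorizations, so that formal power series *)
(* with arbitrary support can be multiplied.                                  *)
HB.mixin Record hasFactors M of MonomialDef M := {
  factors : M -> seq (M * M);
  factors_uniq : forall m, uniq (factors m);
  mem_factors : forall m p, (p \in factors m) = (mmul p.1 p.2 == m)
}.

#[short(type="factMonomType")]
HB.structure Definition FactMonom := { M of MonomialDef M & hasFactors M }.

#[short(type="factConomType")]
HB.structure Definition FactConom := { M of FactMonom M & ConomialDef M }.

(* nat stands for the powers of a single central parameter. *)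
Section NatMonom.

Fact nat_unitm (x y : nat) : (x + y = 0 -> x = 0 /\ y = 0)%N.
Proof. by move/eqP; rewrite addn_eq0 => /andP[/eqP-> /eqP->]. Qed.

HB.instance Definition _ :=
  Choice_isMonomialDef.Build nat addnA add0n addn0 nat_unitm.
HB.instance Definition _ := MonomialDef_isConomialDef.Build nat addnC.

Definition nat_factors (m : nat) := [seq (i, (m - i)%N) | i <- iota 0 m.+1].

Fact nat_factors_uniq m : uniq (nat_factors m).
Proof. by rewrite map_inj_uniq ?iota_uniq// => i j []. Qed.

Fact mem_nat_factors m p : (p \in nat_factors m) = (mmul p.1 p.2 == m).
Proof.
case: p => i j; apply/mapP/eqP => [[k]|<-].
  by rewrite mem_iota ltnS => /= le_km [-> ->]; apply: subnKC.
exists i; last by rewrite [mmul i j]/(i + j)%N addKn.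
by rewrite mem_iota ltnS; apply: leq_addr.
Qed.

HB.instance Definition _ := hasFactors.Build nat nat_factors_uniq mem_nat_factors.

End NatMonom.

Section FreeMonom.
Variable I : choiceType.

Definition fm_factors (m : fmonom I) :=
  [seq (FMonom (take i m), FMonom (drop i m)) | i <- iota 0 (size m).+1].

Fact fm_factors_uniq m : uniq (fm_factors m).
Proof.
rewrite map_inj_in_uniq ?iota_uniq// => i j.
rewrite !mem_iota !ltnS /= => le_im le_jm [eq_ij _].
by have /(congr1 size) := eq_ij; rewrite !size_takel.
Qed.

Fact mem_fm_factors m p : (p \in fm_factors m) = (mmul p.1 p.2 == m).
Proof.
apply/mapP/eqP => [[k _ ->]|<-].
  by apply/val_inj; rewrite /= fmM cat_take_drop.
exists (size p.1).
  by rewrite mem_iota ltnS fmM size_cat leq_addr.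
case: p => -[a] [b]; congr pair; apply/val_inj; rewrite /= fmM /=.
  by rewrite take_size_cat.
by rewrite drop_size_cat.
Qed.

HB.instance Definition _ :=
  hasFactors.Build (fmonom I) fm_factors_uniq mem_fm_factors.

End FreeMonom.

Section CommutativeMonom.
Variable n : nat.
Implicit Types m : cmonom 'I_n.

Definition cm_below m : seq (cmonom 'I_n) :=
  [seq [cmonom (f i : nat) | i in [fset j | j in 'I_n]]%M
    | f : {ffun 'I_n -> 'I_(\sum_i m i).+1}].

Definition cm_factors m :=
  [seq (a, divcm m a) | a <- cm_below m & mmul a (divcm m a) == m].

Let cm_ofE (f : 'I_n -> nat) i :
  [cmonom f i | i in [fset j | j in 'I_n]]%M i = f i.
Proof. by rewrite cmE fsfun_fun ifT //; apply/imfsetP; exists i. Qed.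

Fact cm_factors_uniq m : uniq (cm_factors m).
Proof.
rewrite map_inj_uniq => [|a b []//]; apply: filter_uniq.
rewrite map_inj_uniq ?enum_uniq// => f g /eqP/cmP eq_fg.
by apply/ffunP => i; apply/val_inj; have := eq_fg i; rewrite !cm_ofE.
Qed.

Fact mem_cm_factors m p : (p \in cm_factors m) = (mmul p.1 p.2 == m).
Proof.
case: p => a b; apply/mapP/eqP => /= [[c]|def_m].
  by rewrite mem_filter => /andP[/eqP def_m _] [-> ->].
have def_b : divcm m a = b.
  by apply/eqP/cmP => i; rewrite divcmE -def_m cmM addKn.
exists a; last by rewrite def_b.
rewrite mem_filter def_b def_m eqxx /=.
apply/mapP; exists [ffun i => inord (a i)]; first by rewrite mem_enum.
apply/eqP/cmP => i; rewrite cm_ofE ffunE inordK // ltnS.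
apply: (@leq_trans (m i)); first by rewrite -def_m cmM leq_addr.
by rewrite (bigD1 i) //= leq_addr.
Qed.

HB.instance Definition _ :=
  hasFactors.Build (cmonom 'I_n) cm_factors_uniq mem_cm_factors.

End CommutativeMonom.

(* Formal power series: all families of coefficients indexed by monomials. *)
Definition series (M : factMonomType) (R : Type) : Type := M -> R.

Section SeriesZmodule.
Variables (M : factMonomType) (R : zmodType).
Implicit Types f g : series M R.

HB.instance Definition _ := gen_eqMixin (series M R).
HB.instance Definition _ := gen_choiceMixin (series M R).

Definition series0 : series M R := fun=> 0.
Definition seriesN f : series M R := fun m => - f m.
Definition seriesD f g : series M R := fun m => f m + g m.

Fact seriesDA : associative seriesD.
Proof. by move=> f g h; apply/funext => m; apply: addrA. Qed.
Fact seriesDC : commutative seriesD.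
Proof. by move=> f g; apply/funext => m; apply: addrC. Qed.
Fact series0D : left_id series0 seriesD.
Proof. by move=> f; apply/funext => m; apply: add0r. Qed.
Fact seriesND : left_inverse series0 seriesN seriesD.
Proof. by move=> f; apply/funext => m; apply: addNr. Qed.

HB.instance Definition _ :=
  GRing.isZmodule.Build (series M R) seriesDA seriesDC series0D seriesND.

Lemma series_addE f g m : (f + g) m = f m + g m. Proof. by []. Qed.

End SeriesZmodule.

Section FactorsTheory.
Variables (M : factMonomType) (A : zmodType).

Lemma factors_assoc (phi : M -> M -> M -> A) m :
  \sum_(p <- factors m) \sum_(q <- factors p.2) phi p.1 q.1 q.2 =
  \sum_(p <- factors m) \sum_(q <- factors p.1) phi q.1 q.2 p.2.
Proof.
pose psi (x : M * (M * M)) := phi x.1 x.2.1 x.2.2.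
pose s1 := [seq (p.1, q) | p <- factors m, q <- factors p.2].
pose s2 := [seq (q.1, (q.2, p.2)) | p <- factors m, q <- factors p.1].
transitivity (\sum_(x <- s1) psi x); first by rewrite big_allpairs_dep.
transitivity (\sum_(x <- s2) psi x); last by rewrite big_allpairs_dep.
apply: perm_big; apply: uniq_perm.
- apply: allpairs_uniq_dep => [|p _|]; try exact: factors_uniq.
  move=> x y /allpairsPdep[p [q [Fp Fq ->]]] /allpairsPdep[p' [q' [Fp' Fq' ->]]].
  case: p Fp Fq => p1 p2; case: p' Fp' Fq' => p1' p2' /=.
  rewrite !mem_factors /= => _ /eqP def_p2 _ /eqP def_p2' [eq1 eq_q].
  by rewrite -def_p2 -def_p2' eq1 eq_q.
- apply: allpairs_uniq_dep => [|p _|]; try exact: factors_uniq.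
  move=> x y /allpairsPdep[p [q [Fp Fq ->]]] /allpairsPdep[p' [q' [Fp' Fq' ->]]].
  case: p Fp Fq => p1 p2; case: p' Fp' Fq' => p1' p2' /=.
  case: q => q1 q2; case: q' => q1' q2' /=.
  rewrite !mem_factors /= => _ /eqP def_p1 _ /eqP def_p1' [e1 e2 e3].
  by rewrite -def_p1 -def_p1' e1 e2 e3.
case=> a [b c]; apply/allpairsPdep/allpairsPdep.
  case=> p [q [Fp Fq [-> def_q]]]; move: Fp Fq; rewrite !mem_factors -def_q /=.
  move=> /eqP def_m /eqP def_p2.
  exists (mmul p.1 b, c), (p.1, b); split=> //; rewrite mem_factors //=.
  by rewrite -def_m -def_p2 mulmA.
case=> p [q [Fp Fq [-> -> ->]]]; move: Fp Fq; rewrite !mem_factors /=.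
move=> /eqP def_m /eqP def_p1.
exists (q.1, mmul q.2 p.2), (q.2, p.2); split=> //; rewrite mem_factors //=.
by rewrite -def_m -def_p1 mulmA.
Qed.

Lemma factors_unitl (phi : M -> M -> A) m :
  (forall a b, a != mone -> phi a b = 0) ->
  \sum_(p <- factors m) phi p.1 p.2 = phi mone m.
Proof.
move=> phi0; rewrite (bigD1_seq (mone, m)) ?factors_uniq ?mem_factors ?mul1m//=.
rewrite big_seq_cond big1 ?addr0// => -[a b]; rewrite mem_factors /=.
move=> /andP[/eqP <-]; have [->|/phi0->//] := eqVneq a mone.
by rewrite mul1m eqxx.
Qed.

End FactorsTheory.

Section FactorsUnitr.
Variables (M : factMonomType) (A : zmodType).

Lemma factors_unitr (phi : M -> M -> A) m :
  (forall a b, b != mone -> phi a b = 0) ->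
  \sum_(p <- factors m) phi p.1 p.2 = phi m mone.
Proof.
move=> phi0; rewrite (bigD1_seq (m, mone)) ?factors_uniq ?mem_factors ?mulm1//=.
rewrite big_seq_cond big1 ?addr0// => -[a b]; rewrite mem_factors /=.
move=> /andP[/eqP <-]; have [->|/phi0->//] := eqVneq b mone.
by rewrite mulm1 eqxx.
Qed.

End FactorsUnitr.

Section SeriesRing.
Variables (M : factMonomType) (R : pzRingType).
Implicit Types f g h : series M R.

Definition series1 : series M R := fun m => (m == mone)%:R.
Definition seriesM f g : series M R :=
  fun m => \sum_(p <- factors m) f p.1 * g p.2.

Fact seriesMA : associative seriesM.
Proof.
move=> f g h; apply/funext => m; rewrite /seriesM.
under eq_bigr do rewrite mulr_sumr; under [RHS]eq_bigr do rewrite mulr_suml.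
rewrite (factors_assoc (fun a b c => f a * (g b * h c))).
by do 2!apply: eq_bigr => ? _; rewrite mulrA.
Qed.

Fact series1M : left_id series1 seriesM.
Proof.
move=> f; apply/funext => m; rewrite /seriesM /series1.
rewrite (factors_unitl (phi := fun a b => (a == mone)%:R * f b)).
  by rewrite eqxx mul1r.
by move=> a b /negPf->; rewrite mul0r.
Qed.

Fact seriesM1 : right_id series1 seriesM.
Proof.
move=> f; apply/funext => m; rewrite /seriesM /series1.
rewrite (factors_unitr (phi := fun a b => f a * (b == mone)%:R)).
  by rewrite eqxx mulr1.
by move=> a b /negPf->; rewrite mulr0.
Qed.

Fact seriesMDl : left_distributive seriesM +%R.
Proof.
move=> f g h; apply/funext => m; rewrite series_addE -big_split /=.
by apply: eq_bigr => p _; rewrite mulrDl.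
Qed.

Fact seriesMDr : right_distributive seriesM +%R.
Proof.
move=> f g h; apply/funext => m; rewrite series_addE -big_split /=.
by apply: eq_bigr => p _; rewrite mulrDr.
Qed.

HB.instance Definition _ := GRing.Zmodule_isPzRing.Build (series M R)
  seriesMA series1M seriesM1 seriesMDl seriesMDr.

Definition series_scale (a : R) f : series M R := fun m => a * f m.

Fact series_scaleA a b f :
  series_scale a (series_scale b f) = series_scale (a * b) f.
Proof. by apply/funext => m; apply: mulrA. Qed.
Fact series_scale1 : left_id 1 series_scale.
Proof. by move=> f; apply/funext => m; apply: mul1r. Qed.
Fact series_scaleDr : right_distributive series_scale +%R.
Proof. by move=> a f g; apply/funext => m; apply: mulrDr. Qed.
Fact series_scaleDl f : {morph series_scale^~ f : a b / a + b}.
Proof. by move=> a b; apply/funext => m; apply: mulrDl. Qed.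

HB.instance Definition _ := GRing.Zmodule_isLmodule.Build R (series M R)
  series_scaleA series_scale1 series_scaleDr series_scaleDl.

Lemma series_oneE m : (1 : series M R) m = (m == mone)%:R. Proof. by []. Qed.
Lemma series_mulE f g m : (f * g) m = \sum_(p <- factors m) f p.1 * g p.2.
Proof. by []. Qed.
Lemma series_scaleE a f m : (a *: f) m = a * f m. Proof. by []. Qed.

End SeriesRing.

Section SeriesNzRing.
Variables (M : factMonomType) (R : nzRingType).

Fact series_oner_neq0 : (1 : series M R) != 0.
Proof.
apply/eqP => /(congr1 (fun f : series M R => f mone)).
by move/eqP; rewrite series_oneE eqxx oner_eq0.
Qed.

HB.instance Definition _ :=
  GRing.PzSemiRing_isNonZero.Build (series M R) series_oner_neq0.

Fact series_scaleAl (a : R) (f g : series M R) : a *: (f * g) = (a *: f) * g.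
Proof.
apply/funext => m; rewrite series_scaleE !series_mulE mulr_sumr.
by apply: eq_bigr => p _; rewrite mulrA.
Qed.

HB.instance Definition _ :=
  GRing.Lmodule_isLalgebra.Build R (series M R) series_scaleAl.

End SeriesNzRing.

Section SeriesAlgebra.
Variables (M : factMonomType) (R : comNzRingType).

Fact series_scaleAr (a : R) (f g : series M R) : a *: (f * g) = f * (a *: g).
Proof.
apply/funext => m; rewrite series_scaleE !series_mulE mulr_sumr.
by apply: eq_bigr => p _; rewrite mulrCA.
Qed.

HB.instance Definition _ :=
  GRing.Lalgebra_isAlgebra.Build R (series M R) series_scaleAr.

End SeriesAlgebra.

Section SeriesComRing.
Variables (M : factConomType) (R : comPzRingType).

Fact seriesC : commutative (@seriesM M R).
Proof.
move=> f g; apply/funext => m; rewrite /seriesM.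
rewrite -[RHS](big_map (fun p : M * M => (p.2, p.1)) xpredT
                 (fun p => g p.2 * f p.1)) /=.
under [RHS]eq_bigr do rewrite mulrC.
apply: perm_big; apply: uniq_perm; first exact: factors_uniq.
  by rewrite map_inj_uniq ?factors_uniq// => -[a b] [c d] [-> ->].
move=> [a b]; rewrite mem_factors; apply/idP/mapP => /= [eq_m|[[c d]]].
  by exists (b, a) => //; rewrite mem_factors mulmC.
by rewrite mem_factors /= mulmC => ? [-> ->].
Qed.

HB.instance Definition _ :=
  GRing.PzRing_hasCommutativeMul.Build (series M R) seriesC.

End SeriesComRing.

HB.instance Definition _ (M : factConomType) (R : comNzRingType) :=
  GRing.NzRing.on (series M R).

Definition derivation (R : nzRingType) (A : lalgType R) (D : A -> A) : Prop :=
  linear D /\ forall a b, D (a * b) = D a * b + a * D b.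

(* The algebra of linear endomorphisms, with composition as product. *)
Section LinearOperators.
Variables (R : comPzRingType) (V : lmodType R).

Record linop := LinOp { linop_fun :> V -> V; linopP : linear linop_fun }.

HB.instance Definition _ (f : linop) :=
  GRing.isLinear.Build R V V *:%R f (linopP f).

Lemma linop_ext (f g : linop) : f =1 g -> f = g.
Proof.
case: f g => [f f_lin] [g g_lin] /funext /= eq_fg; case: _ / eq_fg in g_lin *.
by congr LinOp; apply: Prop_irrelevance.
Qed.

HB.instance Definition _ := gen_eqMixin linop.
HB.instance Definition _ := gen_choiceMixin linop.

Definition linop0 := LinOp (linearP (\0 : {linear V -> V})).
Definition linop1 := LinOp (linearP (idfun : {linear V -> V})).
Definition linopN (f : linop) := LinOp (linearP (\- f : {linear V -> V})).
Definition linopD (f g : linop) := LinOp (linearP (f \+ g : {linear V -> V})).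
Definition linopM (f g : linop) := LinOp (linearP (f \o g : {linear V -> V})).

Fact linopDA : associative linopD.
Proof. by move=> f g h; apply: linop_ext => v; apply: addrA. Qed.
Fact linopDC : commutative linopD.
Proof. by move=> f g; apply: linop_ext => v; apply: addrC. Qed.
Fact linop0D : left_id linop0 linopD.
Proof. by move=> f; apply: linop_ext => v; apply: add0r. Qed.
Fact linopND : left_inverse linop0 linopN linopD.
Proof. by move=> f; apply: linop_ext => v; apply: addNr. Qed.

HB.instance Definition _ :=
  GRing.isZmodule.Build linop linopDA linopDC linop0D linopND.

Fact linopMA : associative linopM.
Proof. by move=> f g h; apply: linop_ext. Qed.
Fact linop1M : left_id linop1 linopM.
Proof. by move=> f; apply: linop_ext. Qed.
Fact linopM1 : right_id linop1 linopM.
Proof. by move=> f; apply: linop_ext. Qed.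
Fact linopMDl : left_distributive linopM linopD.
Proof. by move=> f g h; apply: linop_ext. Qed.
Fact linopMDr : right_distributive linopM linopD.
Proof. by move=> f g h; apply: linop_ext => v; apply: raddfD. Qed.

HB.instance Definition _ := GRing.Zmodule_isPzRing.Build linop
  linopMA linop1M linopM1 linopMDl linopMDr.

Definition homothety (a : R) : linop :=
  LinOp (linearP (a \*: (idfun : {linear V -> V}) : {linear V -> V})).

End LinearOperators.

Definition qop (K : comAlgType rat) (V : lmodType K) (q : rat) : linop V :=
  homothety V q%:A.

Notation tseries R := (series nat R).
Notation pseries r R := (series (cmonom 'I_r) R).

Inductive var_kind := Commuting | Free.

Definition zmonom (v : var_kind) (n : nat) : factMonomType :=
  match v with Commuting => {cmonom 'I_n} | Free => {fmonom 'I_n} end.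

Definition zdeg (v : var_kind) (n : nat) : zmonom v n -> nat :=
  match v with Commuting => @mdeg _ | Free => @fdeg _ end.

Definition zvar (v : var_kind) (n : nat) : 'I_n -> zmonom v n :=
  match v with Commuting => @ucm _ | Free => @fmu _ end.

Notation zseries v n R := (series (zmonom v n) R).

Section ZSeries.
Variables (v : var_kind) (n : nat).

Definition zX (R : pzRingType) (i : 'I_n) : zseries v n R :=
  fun w => (w == zvar v i)%:R.

(* o(u) >= k *)
Definition order_ge (R : zmodType) (k : nat) (u : zseries v n R) : Prop :=
  forall w, (zdeg w < k)%N -> u w = 0.

(* K[[t]]<<z>> is identified with K<<z>>[[t]] *)
Definition tcoef (R : Type) (u : zseries v n (tseries R)) (m : nat) :
  zseries v n R := fun w => u w m.

Definition tderiv (R : zmodType) (u : zseries v n (tseries R)) :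
  zseries v n (tseries R) := fun w m => u w m.+1 *+ m.+1.

Section Operators.
Variable K : comAlgType rat.
Local Notation Kz := (zseries v n K).
Local Notation Ktz := (zseries v n (tseries K)).

Inductive diffop (alpha : nat) : linop Kz -> Prop :=
| diffop_derivation (D : linop Kz) :
    derivation D ->
    (forall k u, order_ge k u -> order_ge (k + (alpha - 1)) (D u)) ->
    diffop alpha D
| diffop_scalar (a : K) : diffop alpha (homothety Kz a)
| diffop_add D1 D2 : diffop alpha D1 -> diffop alpha D2 -> diffop alpha (D1 + D2)
| diffop_mul D1 D2 : diffop alpha D1 -> diffop alpha D2 -> diffop alpha (D1 * D2).

Definition over_diffop (alpha : nat) (d : tseries (linop Kz)) : Prop :=
  forall m, diffop alpha (d m).

Definition tact (d : tseries (linop Kz)) (u : Ktz) : Ktz :=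
  fun w m => \sum_(p <- factors m) d p.1 (tcoef u p.2) w.

(* Meant for d 0 = 0, when the truncation discards only zeros (texpE).        *)
Definition texp (d : tseries (linop Kz)) : tseries (linop Kz) :=
  fun m => (\sum_(k < m.+1) qop Kz (k`!%:R^-1) *: d ^+ k) m.

Lemma texp_pow_small (d : tseries (linop Kz)) k m :
  d 0%N = 0 -> (m < k)%N -> (d ^+ k) m = 0.
Proof.
move=> d0; elim: k m => // k IHk m lt_mk.
rewrite exprS series_mulE big_seq big1 // => -[i j].
rewrite mem_factors => /eqP/= def_m; have [->|i_gt0] := posnP i.
  by rewrite d0 mul0r.
rewrite IHk ?mulr0 //; rewrite -ltnS; apply: leq_trans lt_mk.
by rewrite -def_m ltnS -[mmul i j]/(i + j)%N -[X in (X < _)%N]add0n ltn_add2r.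
Qed.

Lemma texpE (d : tseries (linop Kz)) m N : d 0%N = 0 -> (m < N)%N ->
  texp d m = (\sum_(k < N) qop Kz (k`!%:R^-1) *: d ^+ k) m.
Proof.
move=> d0 lt_mN; rewrite /texp.
pose s k := qop Kz (k`!%:R^-1) *: d ^+ k.
rewrite -(big_mkord xpredT s) -(big_mkord xpredT s).
rewrite [in RHS](big_cat_nat _ lt_mN) //= series_addE.
suff -> : (\sum_(m.+1 <= k < N) s k) m = 0 by rewrite addr0.
rewrite big_seq; elim/big_rec: _ => // k u.
rewrite mem_index_iota => /andP[lt_mk _] um0.
by rewrite series_addE um0 addr0 /s series_scaleE texp_pow_small // mulr0.
Qed.

(* By K[[t]]-linearity and multiplicativity, an automorphism F satisfying     *)
(* this (with alpha >= 1) is the substitution u |-> u(F_t), F_t = F(z).       *)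
Definition in_At (alpha : nat) (F : Ktz -> Ktz) : Prop :=
  forall i, let H := zX (tseries K) i - F (zX (tseries K) i) in
  order_ge alpha H /\ tcoef H 0 = 0.

End Operators.
End ZSeries.

Arguments zX v {n} R i.

(* \sum_(r >= 1) s r = f for the t-adic topology *)
Definition is_tsum (A : zmodType) (s : nat -> tseries A) (f : tseries A) : Prop :=
  forall m, exists N0, forall N, (N0 <= N)%N -> (\sum_(1 <= r < N) s r) m = f m.

Section ParameterIntegrals.
Variables (K : comAlgType rat) (V : lmodType K).
Local Notation A := (linop V).

(* h(t_j), as a power series in t_0, ..., t_(r-1) *)
Definition at_param (r : nat) (j : 'I_r) (h : tseries A) : pseries r A :=
  fun k => if [forall i, (i != j) ==> (k i == 0%N)] then h (k j) else 0.

(* The antiderivative in t_j that vanishes at t_j = 0. *)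
Definition primitive (r : nat) (j : 'I_r) (f : pseries r A) : pseries r A :=
  fun k => if k j == 0%N then 0 else qop V (k j)%:R^-1 * f (divcm k (ucm j)).

(* The substitution t_j := t_i, for i != j. *)
Definition set_param (r : nat) (j i : 'I_r) (f : pseries r A) : pseries r A :=
  fun k => if k j == 0%N then
    \sum_(b < (k i).+1)
      f (mmul (divcm k (expcmn (ucm i) b)) (expcmn (ucm j) b))
  else 0.

(* \int_0^(t_i) f dt_j *)
Definition integral (r : nat) (j i : 'I_r) (f : pseries r A) : pseries r A :=
  set_param j i (primitive j f).

(* \int_0^(t_0) dt_1 \int_0^(t_1) dt_2 ... \int_0^(t_(r-1)) dt_r f, as a      *)
(* power series in t = t_0 (the other parameters no longer occur).            *)
Definition iterated_integral (r : nat) (f : pseries r.+1 A) : tseries A :=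
  fun m => foldr
    (fun j : 'I_r => integral (lift ord0 j) (widen_ord (leqnSn r) j))
    f (enum 'I_r) (expcmn (ucm ord0) m).

End ParameterIntegrals.

Definition descents (r : nat) (s : {perm 'I_r}) : nat :=
  #|[set i : 'I_r | [exists j : 'I_r, (j == i.+1 :> nat) && (s j < s i)%N]]|.

(* Main.v *)
Require Import Defs.
From HB Require Import structures.
From mathcomp Require Import all_boot all_order all_algebra all_fingroup.
From mathcomp Require Import boolp finmap monalg zify ring.

Set Implicit Arguments.
Unset Strict Implicit.
Unset Printing Implicit Defensive.

Import GRing.Theory Num.Theory.
Local Open Scope ring_scope.

(** Write E = e^d for the power series of operators with E u = u(G_t).

    The differential equation.  The operator F (d/dt) G - d/dt is a derivation
    over K[[t]] which agrees with h on the variables z_i, hence everywhere: a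
    derivation killing the variables is zero, because writing a series as its
    constant term plus the sum of the z_i u_i shows inductively that its values
    have arbitrarily large order.  On series that do not involve t this reads
    dE/dt = E h, with E(0) = 1 (flow_equation).  Therefore E is the sum of the
    iterated integrals of h(t_r) ... h(t_1) over t > t_1 > ... > t_r > 0, and d
    is its logarithm.

    Words.  Everything after that is universal in h, so it is carried out with
    formal series in noncommuting letters: the word k_1 ... k_r stands for the
    product of the coefficients of t^(k_1), ..., t^(k_r) in h, and since
    integration raises degrees it weighs (k_1 + 1) + ... + (k_r + 1).
    Evaluation ev of such series is a ring morphism.  In word series E becomes
    flow_series, whose coefficients are products of inverse weights, d becomes
    log_sum (flow_series - 1), thanks to log (exp X) = X (log_texp), and d/dt
    becomes multiplication by the weight.

    The logarithm.  For a central parameter x the resolvent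
    R = (1 - x (E - 1))^-1 = sum_k x^k (E - 1)^k satisfies the closed equation
    dR/dt = ((1 + x) R - 1) h R.  On the other side, summing
    x^(des + 1) (1 + x)^(asc) times the simplex integral over all orderings of
    the letters of a word obeys the same equation: the letter that carries the
    latest time splits the word into a left and a right factor, whose orderings
    are shuffled independently (filling_sum_rec, filling_sum_cat), and the
    letters next to it contribute the powers of x and 1 + x
    (wder_order_series).  The equation has one solution with constant term 1,
    so both series agree (order_series_resolvent, order_coef_expansion).
    Finally the linear map sending x^k to (-1)^(k-1)/k, which is integration of
    p(x)/x from -1 to 0, turns the sum of the x^k (E - 1)^k into log E and
    x^(a+1) (1 + x)^b into (-1)^a a! b!/(a + b + 1)! (log_functional_beta).
    With a descents among r letters and b = r - 1 - a, this is the coefficient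
    (-1)^a / (r C(r-1, a)).

    It remains to expand the iterated integrals into simplex coefficients
    (iterated_integralE) and to match permutations with orderings of positions
    (sum_permutations, succ_after_time_order). *)

(** * Power series in z and their derivations *)

Lemma big_iota (A : nmodType) r (F : nat -> A) :
  \sum_(i <- iota 0 r) F i = \sum_(i < r) F i.
Proof. by rewrite -(big_mkord xpredT F) /index_iota subn0. Qed.

Section PowerSeries.
Variables (M : factMonomType) (R : zmodType).

Lemma series_sumE I (s : seq I) (P : pred I) (F : I -> series M R) m :
  (\sum_(i <- s | P i) F i) m = \sum_(i <- s | P i) F i m.
Proof. by elim/big_rec2: _ => //= i x y _ <-. Qed.

Lemma series_oppE (f : series M R) m : (- f) m = - f m.
Proof. by []. Qed.

End PowerSeries.

Section ZMonomials.
Variables (v : var_kind) (n : nat).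
Local Notation Z := (zmonom v n).

Lemma zvar_mulI (i : 'I_n) : injective (fun b : Z => mmul (zvar v i) b).
Proof.
case: v => a b /=.
  move=> /(congr1 (fun m : cmonom 'I_n => fun j => m j)) eq_ab.
  apply/eqP/cmP => j; have /(congr1 (fun f => f j)) := eq_ab.
  by rewrite /= !cmM => /addnI.
move=> /(congr1 (fun m : fmonom 'I_n => m : seq _)); rewrite !fmM => /eqP.
by rewrite eqseq_cat // eqxx /= => /eqP eq_ab; apply/val_inj.
Qed.

Lemma zmonom_zvar_mul (m : Z) : m != mone ->
  exists i : 'I_n, exists b : Z, mmul (zvar v i) b = m.
Proof.
case: v m => /= m m_neq1.
  have [i mi] : exists i : 'I_n, m i != 0%N.
    apply/existsP; apply: contraR m_neq1; rewrite negb_exists => /forallP m0.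
    by apply/cmP => i; rewrite cm1; apply/eqP; have := m0 i; rewrite negbK.
  exists i, (divcm m (ucm i)); apply/eqP/cmP => j; rewrite cmM divcmE.
  rewrite -[_ j]/(ucm i j) ucmE; case: eqVneq => [<-|_]; last by rewrite subn0.
  by rewrite addnC subnK // lt0n.
case: m m_neq1 => -[|i s] m_neq1.
  by case/eqP: m_neq1; apply/val_inj; rewrite /= fm1.
by exists i, (FMonom s); apply/val_inj; rewrite /= fmM fmU.
Qed.

Lemma zdegM (a b : Z) : zdeg (mmul a b) = (zdeg a + zdeg b)%N.
Proof. by case: v a b => a b; [exact: mdegM|exact: fdegM]. Qed.

Lemma zdeg1 : zdeg (mone : Z) = 0%N.
Proof. by case: v; [exact: mdeg1|exact: fdeg1]. Qed.

Lemma zdeg_zvar i : zdeg (zvar v i : Z) = 1%N.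
Proof. by case: v; [exact: mdegU|exact: fdegU]. Qed.

Variable R : nzRingType.

Lemma zX_mulE (i : 'I_n) (u : zseries v n R) m :
  (zX v R i * u) m = \sum_(p <- factors m | p.1 == zvar v i) u p.2.
Proof.
rewrite series_mulE [RHS]big_mkcond; apply: eq_bigr => p _.
by rewrite /zX; case: eqP => _; rewrite ?mul1r ?mul0r.
Qed.

Lemma zX_mul_zvar (i : 'I_n) (u : zseries v n R) b :
  (zX v R i * u) (mmul (zvar v i) b) = u b.
Proof.
rewrite zX_mulE (big_rem (zvar v i, b)) ?mem_factors //= eqxx.
rewrite big_seq_cond big1 ?addr0 // => -[p q] /andP[].
rewrite (mem_rem_uniq _ (factors_uniq _)) inE mem_factors /= => /andP[neq /eqP].
by move=> eq_m /eqP def_p; case/eqP: neq; move: eq_m;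
  rewrite def_p => /zvar_mulI ->.
Qed.

Lemma zX_mul_eq0 (i : 'I_n) (u : zseries v n R) m :
  (forall b, mmul (zvar v i) b != m) -> (zX v R i * u) m = 0.
Proof.
move=> ndiv; rewrite zX_mulE big_seq_cond big1 // => -[p q] /=.
by rewrite mem_factors => /andP[/eqP def_m /eqP def_p]; have := ndiv q;
  rewrite -def_p def_m eqxx.
Qed.

Lemma order_ge_zX_mul k (i : 'I_n) (u : zseries v n R) :
  order_ge k u -> order_ge k.+1 (zX v R i * u).
Proof.
move=> u_k m lt_mk; rewrite zX_mulE big_seq_cond big1 // => -[p q] /=.
rewrite mem_factors => /andP[/eqP/= def_m /eqP def_p]; apply: u_k.
by rewrite -def_m def_p zdegM zdeg_zvar in lt_mk.
Qed.

(** Each monomial other than 1 is charged to one chosen variable dividing it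
    on the left, which works alike for commuting and for free variables; g i
    collects the quotients of the monomials charged to z_i. *)
Lemma series_zX_decomposition (u : zseries v n R) :
  exists g : 'I_n -> zseries v n R, u = u mone *: 1 + \sum_i zX v R i * g i.
Proof.
have fst_ex (m : Z) : m != mone ->
  exists i, `[< exists b, mmul (zvar v i) b = m >].
  by move=> /zmonom_zvar_mul[i [b def_m]]; exists i; apply/asboolP; exists b.
pose fst (m : Z) := [pick i | `[< exists b, mmul (zvar v i) b = m >]].
exists (fun i b => if fst (mmul (zvar v i) b) == Some i
                   then u (mmul (zvar v i) b) else 0).
apply/funext => m; rewrite series_addE series_sumE series_scaleE series_oneE.
have [->|m_neq1] := eqVneq m mone.
  rewrite mulr1 big1 ?addr0 // => i _; apply: zX_mul_eq0 => b.
  by apply/eqP => /(congr1 (@zdeg v n)); rewrite zdegM zdeg_zvar zdeg1.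
rewrite mulr0 add0r.
case def_i: (fst m) => [i|]; last first.
  have [i mi] := fst_ex m m_neq1; move: def_i; rewrite /fst.
  by case: pickP => // /(_ i); rewrite mi.
have [b def_m] : exists b, mmul (zvar v i) b = m.
  by move: def_i; rewrite /fst; case: pickP => // j /asboolP mj [<-].
rewrite (bigD1 i) //= -{2}def_m zX_mul_zvar def_m def_i eqxx big1 ?addr0 //.
move=> j neq_ji; rewrite zX_mulE big_seq_cond big1 // => -[p q] /=.
rewrite mem_factors => /andP[/eqP/= def_m' /eqP def_p].
by rewrite -def_p def_m' def_i; case: eqP => // -[/eqP];
  rewrite eq_sym (negPf neq_ji).
Qed.

Lemma order_ge_all_eq0 (u : zseries v n R) :
  (forall k, order_ge k u) -> u = 0.
Proof. by move=> u_ord; apply/funext => m; apply: (u_ord (zdeg m).+1). Qed.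

(** By induction on k, every value has order at least k: applying D to the
    decomposition c + sum_i z_i g_i leaves only the terms z_i (D g_i). *)
Lemma derivation_eq0 (D : zseries v n R -> zseries v n R) :
  derivation D -> (forall i, D (zX v R i) = 0) -> forall u, D u = 0.
Proof.
case=> D_lin D_mul D_var u.
pose L := GRing.isLinear.Build R _ _ *:%R D D_lin.
pose D' : {linear zseries v n R -> zseries v n R} := HB.pack D L.
have D1 : D 1 = 0.
  by apply/(@addIr _ (D 1)); rewrite add0r -{3}[1]mulr1 D_mul mulr1 mul1r.
apply: order_ge_all_eq0 => k; elim: k u => [|k IHk] u //.
have [g ->] := series_zX_decomposition u.
rewrite -[D _]/(D' _) linearD linearZ linear_sum /= D1 scaler0 add0r => m m_k.
rewrite series_sumE big1 // => i _.
by rewrite D_mul D_var mul0r add0r (order_ge_zX_mul _ (IHk _)).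
Qed.

End ZMonomials.

(** * Multiplication of coefficients by an additive weight *)

Section WeightDerivation.
Variables (M : factMonomType) (R : pzRingType) (w : M -> nat).

Definition wder (f : series M R) : series M R := fun m => f m *+ w m.

Lemma wderD : {morph wder : f g / f + g}.
Proof. by move=> f g; apply/funext => m; rewrite /wder series_addE mulrnDl. Qed.

Lemma wder0 : wder 0 = 0.
Proof. by apply/funext => m; rewrite /wder mul0rn. Qed.

Lemma wderN : {morph wder : f / - f}.
Proof. by move=> f; apply/funext => m; rewrite /wder series_oppE mulNrn. Qed.

Lemma wderB : {morph wder : f g / f - g}.
Proof. by move=> f g; rewrite wderD wderN. Qed.

Lemma wderZ a : {morph wder : f / a *: f}.
Proof. by move=> f; apply/funext => m;
  rewrite /wder !series_scaleE mulrnAr. Qed.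

Hypothesis wM : forall a b, w (mmul a b) = (w a + w b)%N.

Lemma wderM f g : wder (f * g) = wder f * g + f * wder g.
Proof.
apply/funext => m;
  rewrite /wder series_addE !series_mulE -sumrMnl -big_split /=.
rewrite big_seq [RHS]big_seq; apply: eq_bigr => p.
by rewrite mem_factors => /eqP <-; rewrite wM mulrnDr mulrnAl mulrnAr.
Qed.

Lemma wder1 : wder 1 = 0.
Proof.
have := wderM 1 1; rewrite !mulr1 mul1r => /eqP.
by rewrite -subr_eq subrr => /eqP.
Qed.

End WeightDerivation.

Definition tvar (R : pzRingType) : tseries R := fun m => (m == 1)%:R.

Section TSeries.
Variable R : pzRingType.

Lemma tseries_mulE (f g : tseries R) m :
  (f * g) m = \sum_(i < m.+1) f i * g (m - i)%N.
Proof. by rewrite series_mulE big_map big_iota. Qed.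

Lemma tvar_mulS (f : tseries R) m : (tvar R * f) m.+1 = f m.
Proof.
rewrite tseries_mulE big_ord_recl big_ord_recl /= mul0r mul1r add0r subSS subn0.
by rewrite big1 ?addr0 // => i _; rewrite mul0r.
Qed.

Lemma tvar_mul0 (f : tseries R) : (tvar R * f) 0%N = 0.
Proof. by rewrite tseries_mulE big_ord1 mul0r. Qed.

End TSeries.

(** * The differential equation of the exponential *)

Section FlowEquation.
Variables (K : comAlgType rat) (v : var_kind) (n : nat).
Local Notation Kz := (zseries v n K).
Local Notation Ktz := (zseries v n (tseries K)).
Local Notation theta := (@wder nat K id).
Implicit Types u : Ktz.

Let tder_t u : Ktz := fun w => theta (u w).

Let thetaM : forall f g : tseries K, theta (f * g) = theta f * g + f * theta g.
Proof. exact: wderM. Qed.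

Let tder_tM u1 u2 : tder_t (u1 * u2) = tder_t u1 * u2 + u1 * tder_t u2.
Proof.
apply/funext => w; rewrite series_addE !series_mulE -big_split /= /tder_t.
rewrite series_mulE (big_morph _ (@wderD nat K id) (@wder0 nat K id)).
by apply: eq_bigr => p _; rewrite thetaM.
Qed.

Let tder_tZ (a : tseries K) u :
  tder_t (a *: u) = theta a *: u + a *: tder_t u.
Proof. by apply/funext => w;
  rewrite /tder_t series_addE !series_scaleE thetaM. Qed.

Let tder_tD u1 u2 : tder_t (u1 + u2) = tder_t u1 + tder_t u2.
Proof. by apply/funext => w; rewrite /tder_t series_addE wderD. Qed.

Let tder_tN u : tder_t (- u) = - tder_t u.
Proof. by apply/funext => w; rewrite /tder_t series_oppE wderN. Qed.

Let tder_tE u : tder_t u = tvar K *: tderiv u.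
Proof.
apply/funext => w; rewrite series_scaleE; apply/funext => -[|m].
  by rewrite tvar_mul0.
by rewrite tvar_mulS.
Qed.

Let tconst (c : Kz) : Ktz := fun w m => if m == 0%N then c w else 0.

(** Series that do not involve t separate the coefficients of an operator
    series. *)
Lemma tact_tconst (e : tseries (linop Kz)) (c : Kz) m :
  tcoef (tact e (tconst c)) m = e m c.
Proof.
apply/funext => w.
rewrite -[LHS]/(\sum_(p <- factors m) e p.1 (tcoef (tconst c) p.2) w).
rewrite big_map big_iota big_ord_recr /= subnn big1 => [|i _].
  by rewrite add0r.
have -> : tcoef (tconst c) (m - i) = 0.
  by apply/funext => w'; rewrite /tcoef /tconst subn_eq0 leqNgt ltn_ord.
by rewrite linear0.
Qed.

Lemma tact_mul_tconst (e g : tseries (linop Kz)) (c : Kz) m :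
  tcoef (tact e (tact g (tconst c))) m = (e * g) m c.
Proof.
rewrite series_mulE.
have linop_sumE (s : seq (nat * nat)) (f : nat * nat -> linop Kz) x :
    (\sum_(p <- s) f p) x = \sum_(p <- s) f p x.
  by elim/big_rec2: _ => //= p y z _ <-.
rewrite linop_sumE; apply/funext => w; rewrite series_sumE.
rewrite -[LHS]/(\sum_(p <- factors m) e p.1 (tcoef (tact g (tconst c)) p.2) w).
by apply: eq_bigr => p _; rewrite tact_tconst.
Qed.

Variables (F G : {lrmorphism Ktz -> Ktz}) (e h : tseries (linop Kz)).
Hypotheses (GK : cancel G F) (FK : cancel F G).
Hypothesis act_e : forall u, tact e u = G u.
Hypothesis h_der : derivation (tact h).
Hypothesis act_h : forall i, tact h (zX v (tseries K) i) =
  F (tderiv (G (zX v (tseries K) i) - zX v (tseries K) i)).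

(** The difference of the two sides is a K[[t]]-derivation, since the Leibniz
    term produced by d/dt of a scalar cancels; it vanishes on the variables.
    The Euler operator t d/dt replaces d/dt so that it is the weight
    derivation of series in t. *)
Lemma flow_derivation u :
  F (tder_t (G u)) = tder_t u + tvar K *: tact h u.
Proof.
case: (h_der) => h_lin hM.
pose D u := F (tder_t (G u)) - tder_t u - tvar K *: tact h u.
suff : D u = 0 by move/eqP; rewrite subr_eq0 subr_eq addrC => /eqP.
apply: derivation_eq0 => [|i]; last first.
  have z0 : tder_t (zX v (tseries K) i) = 0.
    apply/funext => w; rewrite /tder_t /zX; case: (w == _).
      exact: wder1.
    exact: wder0.
  rewrite /D z0 subr0 act_h.
  rewrite -linearZ /= -tder_tE.
  by rewrite tder_tD tder_tN z0 subr0 subrr.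
have FD u1 u2 : F (u1 + u2) = F u1 + F u2 by rewrite rmorphD.
have DD u1 u2 : D (u1 + u2) = D u1 + D u2.
  have := h_lin 1 u1 u2; rewrite !scale1r /D => ->.
  rewrite !tder_tD (rmorphD G) tder_tD FD scalerDr !opprD.
  by rewrite (addrACA (F _)) [LHS]addrACA.
have DZ a u1 : D (a *: u1) = a *: D u1.
  have h0 : tact h 0 = 0.
    have := h_lin 1 0 0; rewrite !scale1r addr0 => /eqP.
    by rewrite -subr_eq subrr => /eqP.
  have := h_lin a u1 0; rewrite addr0 h0 addr0 /D => ->.
  have FZ (b : tseries K) u2 : F (b *: u2) = b *: F u2 by rewrite linearZ.
  have GZ (b : tseries K) u2 : G (b *: u2) = b *: G u2 by rewrite linearZ.
  rewrite GZ !tder_tZ FD !FZ GK.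
  rewrite !scalerBr !scalerA.
  by rewrite opprD addrACA subrr add0r [tvar K * a]mulrC.
split=> [a u1 u2|u1 u2]; first by rewrite DD DZ.
have FM : {morph F : x y / x * y} by exact: rmorphM.
have GM : {morph G : x y / x * y} by exact: rmorphM.
rewrite /D hM GM !tder_tM FD !FM !GK.
by rewrite !mulrBl !mulrBr scalerDr scalerAl scalerAr !opprD
  (addrACA (F _ * _)) [LHS]addrACA.
Qed.

(** This is dE/dt = E h coefficient by coefficient, read off by applying G to
    the preceding identity on series that do not involve t, which determine an
    operator series. *)
Lemma flow_equation m : e m.+1 *+ m.+1 = (e * h) m.
Proof.
apply: linop_ext => c.
have c_t : tder_t (tconst c) = 0.
  apply/funext => w; apply/funext => -[|k];
    first by rewrite /tder_t /wder mulr0n.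
  by rewrite /tder_t /wder mul0rn.
have := flow_derivation (tconst c); rewrite c_t add0r => /(congr1 G).
rewrite FK linearZ /= -!act_e => /(congr1 (fun u => tcoef u m.+1)).
rewrite -tact_mul_tconst => eq_m.
transitivity (tcoef (tder_t (tact e (tconst c))) m.+1).
  rewrite (_ : (e m.+1 *+ m.+1) c = (e m.+1 c) *+ m.+1); last first.
    by elim: {2 4}m.+1 => // k IHk; rewrite !mulrS -IHk.
  rewrite -tact_tconst; apply/funext => w.
  rewrite /tcoef /tder_t /wder.
  by elim: {2 4}m.+1 => // k IHk; rewrite !mulrS -IHk.
rewrite eq_m; apply/funext => w.
by rewrite /tcoef series_scaleE tvar_mulS.
Qed.

End FlowEquation.

(** * Words and their evaluation as operators *)

Section RationalOperators.
Variables (K : comAlgType rat) (V : lmodType K).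
Local Notation q := (@qop K V).

Fact qop_zmod_morphism : zmod_morphism q.
Proof. by move=> a b; apply: linop_ext => x; rewrite /= scalerBl scalerBl. Qed.

Fact qop_monoid_morphism : monoid_morphism q.
Proof.
split=> [|a b]; apply: linop_ext => x; first by rewrite /= !scale1r.
by rewrite /= scalerA -scalerAl mul1r scalerA.
Qed.

HB.instance Definition _ := GRing.isZmodMorphism.Build rat (linop V) q
  qop_zmod_morphism.
HB.instance Definition _ := GRing.isMonoidMorphism.Build rat (linop V) q
  qop_monoid_morphism.

Lemma qop_comm a (f : linop V) : q a * f = f * q a.
Proof. by apply: linop_ext => x; rewrite /= linearZ. Qed.

(** Operators form a rational vector space through qop, hence have no
    torsion. *)
Lemma linop_mulrnI m : injective (fun f : linop V => f *+ m.+1).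
Proof.
have mulKn f : q (m.+1%:R^-1) * (f *+ m.+1) = f.
  rewrite -[f *+ _]mulr_natl mulrA -(rmorph_nat q) -rmorphM /= mulVf ?pnatr_eq0
    //.
  by rewrite rmorph1 mul1r.
by move=> f g /= eq_fg; rewrite -[f]mulKn eq_fg mulKn.
Qed.

End RationalOperators.

(** The letter k stands for h_k t^k dt, which contributes degree k + 1 after
    integration. *)
Definition weight (w : seq nat) : nat := sumn (map succn w).

Fixpoint words (r m : nat) : seq (seq nat) :=
  if r is r'.+1 then [seq k :: w | k <- iota 0 m, w <- words r' (m - k.+1)]
  else if m == 0%N then [:: [::]] else [::].

Lemma mem_words r m w : (w \in words r m) = (size w == r) && (weight w == m).
Proof.
elim: r m w => [|r IHr] m w /=.
  by case: (altP (m =P 0%N)) => [->|m_neq0]; case: w => //=;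
    rewrite /weight /= ?inE // eq_sym (negPf m_neq0).
apply/allpairsPdep/andP => [[k [w' []]]|[]].
  rewrite mem_iota add0n IHr => /= lt_km /andP[/eqP <- /eqP def_w] ->.
  by rewrite eqxx /weight /= -/(weight _) def_w subnKC.
case: w => // k w; rewrite eqSS => sz_w /eqP <-; exists k, w.
by rewrite mem_iota /weight /= add0n leq_addr IHr sz_w -/(weight _) addKn eqxx.
Qed.

Lemma words_uniq r m : uniq (words r m).
Proof.
elim: r m => [|r IHr] m /=; first by case: ifP.
apply: allpairs_uniq_dep => [|k _|]; rewrite ?iota_uniq ?IHr //.
by move=> /= _ _ /allpairsPdep[k [w [_ _ ->]]] /allpairsPdep[k' [w' [_ _ ->]]]
  [-> ->].
Qed.

Lemma weight_cat u w : weight (u ++ w) = (weight u + weight w)%N.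
Proof. by rewrite /weight map_cat sumn_cat. Qed.

Lemma size_le_weight w : (size w <= weight w)%N.
Proof. by elim: w => //= k w IHw;
  rewrite /weight /= addSn ltnS (leq_trans IHw) ?leq_addl. Qed.

Definition all_words m : seq {fmonom nat} :=
  [seq FMonom w | w <- flatten [seq words r m | r <- iota 0 m.+1]].

Lemma mem_all_words m (w : {fmonom nat}) : (w \in all_words m) =
  (weight w == m).
Proof.
apply/mapP/eqP => [[s /flatten_mapP[r _]]|].
  by rewrite mem_words => /andP[_ /eqP def_m] ->.
move=> def_m; exists (w : seq nat); last by case: w {def_m}.
apply/flatten_mapP; exists (size w); last by rewrite mem_words def_m !eqxx.
by rewrite mem_iota ltnS -def_m size_le_weight.
Qed.

Lemma all_words_uniq m : uniq (all_words m).
Proof.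
rewrite map_inj_uniq => [|u w []//].
have: uniq [seq w | r <- iota 0 m.+1, w <- words r m].
  apply: allpairs_uniq_dep => [|r _|]; rewrite ?iota_uniq ?words_uniq //.
  move=> _ _ /allpairsPdep[r [w [_ Ww ->]]] /allpairsPdep[r' [w' [_ Ww' ->]]]
    /= eq_w.
  move: Ww Ww'; rewrite -eq_w !mem_words => /andP[/eqP <- _] /andP[/eqP <- _].
  by [].
by congr uniq; congr flatten; apply: eq_map => r; rewrite map_id.
Qed.

Lemma sum_all_words (A : zmodType) (F : {fmonom nat} -> A) m :
  \sum_(w <- all_words m) F w =
  \sum_(r < m.+1) \sum_(w <- words r m) F (FMonom w).
Proof.
by rewrite /all_words big_map big_flatten big_map big_iota.
Qed.

Section Evaluation.
Variables (K : comAlgType rat) (V : lmodType K).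
Local Notation A := (linop V).
Local Notation q := (@qop K V).
Local Notation NS := (series {fmonom nat} rat).
Variable a : nat -> A.
Implicit Types (f g : NS).

Definition ev f : tseries A :=
  fun m => \sum_(w <- all_words m) q (f w) * \prod_(k <- (w : seq nat)) a k.

Lemma eq_ev m f g :
  (forall w : {fmonom nat}, weight w = m -> f w = g w) -> ev f m = ev g m.
Proof.
move=> eq_fg; rewrite /ev big_seq [RHS]big_seq; apply: eq_bigr => w.
by rewrite mem_all_words => /eqP/eq_fg ->.
Qed.

Lemma evD : {morph ev : f g / f + g}.
Proof.
move=> f g; apply/funext => m; rewrite series_addE /ev -big_split.
by apply: eq_bigr => w _; rewrite series_addE rmorphD mulrDl.
Qed.

Lemma evZ c f m : ev (c *: f) m = q c * ev f m.
Proof.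
rewrite /ev mulr_sumr; apply: eq_bigr => w _.
by rewrite series_scaleE rmorphM mulrA.
Qed.

Lemma ev0 : ev 0 = 0.
Proof. by apply: (@addIr _ (ev 0)); rewrite -evD !add0r. Qed.

Lemma evN f : ev (- f) = - ev f.
Proof. by apply/eqP; rewrite -addr_eq0 -evD addNr ev0. Qed.

Lemma ev_sum I (s : seq I) (F : I -> NS) : ev (\sum_(i <- s) F i) =
  \sum_(i <- s) ev (F i).
Proof. by apply: (big_morph ev evD ev0). Qed.

(** Both sides enumerate pairs of words of total weight m: as the cuts of a
    word, or as a cut of m followed by two words. *)
Lemma evM f g : ev (f * g) = ev f * ev g.
Proof.
apply/funext => m; rewrite series_mulE /ev.
pose s1 := [seq p | w <- all_words m, p <- factors w].
pose s2 := [seq x | p <- factors m,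
  x <- [seq (u, w) | u <- all_words p.1, w <- all_words p.2]].
pose psi (p : {fmonom nat} * {fmonom nat}) :=
  (q (f p.1) * \prod_(k <- (p.1 : seq nat)) a k)
    * (q (g p.2) * \prod_(k <- (p.2 : seq nat)) a k).
transitivity (\sum_(x <- s1) psi x).
  rewrite big_allpairs_dep /=; apply: eq_bigr => w _.
  rewrite series_mulE rmorph_sum mulr_suml big_seq [RHS]big_seq.
  apply: eq_bigr => p; rewrite mem_factors => /eqP <-.
  rewrite fmM big_cat /= rmorphM /psi -!mulrA; congr (_ * _).
  by rewrite !mulrA; congr (_ * _); apply: qop_comm.
transitivity (\sum_(x <- s2) psi x); last first.
  rewrite big_allpairs_dep /=; apply: eq_bigr => p _.
  rewrite big_allpairs_dep /= mulr_suml; apply: eq_bigr => u _.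
  by rewrite mulr_sumr.
apply: perm_big; apply: uniq_perm.
- apply: allpairs_uniq_dep => [|w _|]; rewrite ?all_words_uniq ?factors_uniq //.
  move=> _ _ /allpairsPdep[w [p [_ Fp ->]]] /allpairsPdep[w' [p' [_ Fp' ->]]]
    /= eq_p.
  by move: Fp Fp'; rewrite -eq_p !mem_factors => /eqP <- /eqP <-.
- apply: allpairs_uniq_dep => [|p _|]; rewrite ?factors_uniq //.
    apply: allpairs_uniq_dep => [|u _|]; rewrite ?all_words_uniq //.
    by move=> [u1 w1] [u2 w2] _ _ /= [-> ->].
  move=> _ _ /allpairsPdep[p [x [_ Fp ->]]] /allpairsPdep[p' [x' [_ Fp' ->]]]
    /= eq_x.
  move: Fp Fp'; rewrite -eq_x =>
    /allpairsPdep[u [w [Wu Ww ->]]] /allpairsPdep[u' [w' [Wu' Ww' []]]].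
  move=> eq_u eq_w; move: Wu Ww Wu' Ww'; rewrite -eq_u -eq_w !mem_all_words.
  by case: p p' => [i j] [i' j'] /= /eqP -> /eqP -> /eqP -> /eqP ->.
case=> u w; apply/allpairsPdep/allpairsPdep => -[x [y []]].
  rewrite mem_all_words mem_factors => /eqP def_m /eqP def_x def_y.
  exists (weight u, weight w), (u, w); split=> //.
    rewrite mem_factors /= -def_m -def_x -def_y fmM weight_cat; exact: eqxx.
  by apply/allpairsPdep; exists u, w; rewrite !mem_all_words !eqxx.
rewrite mem_factors => /eqP <- /allpairsPdep[u' [w' [Wu Ww ->]]] [def_u def_w].
exists (mmul u w), (u, w); split=> //; last by rewrite mem_factors.
move: Wu Ww; rewrite -def_u -def_w !mem_all_words fmM weight_cat.
by move=> /eqP -> /eqP ->; exact: eqxx.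
Qed.

Lemma ev1 : ev 1 = 1.
Proof.
apply/funext => m; rewrite series_oneE /ev.
have [->|m_gt0] := posnP m.
  rewrite big_seq1 series_oneE (_ : mone = FMonom [::]); last exact: fmoneE.
  by rewrite eqxx big_nil mulr1 rmorph1.
rewrite big_seq big1 // => w; rewrite mem_all_words => /eqP def_m.
rewrite series_oneE; case: eqP => [w1|_]; last by rewrite rmorph0 mul0r.
by rewrite -def_m w1 fm1 in m_gt0.
Qed.

Lemma evX f k : ev (f ^+ k) = ev f ^+ k.
Proof. by elim: k => [|k IHk]; rewrite ?ev1 // !exprS evM IHk. Qed.

(** Multiplication by the weight is the counterpart of t d/dt. *)
Lemma ev_wder f m : ev (wder (weight : {fmonom nat} -> nat) f) m = ev f m *+ m.
Proof.
rewrite /ev -sumrMnl big_seq [RHS]big_seq; apply: eq_bigr => w.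
by rewrite mem_all_words => /eqP <-; rewrite /wder rmorphMn mulrnAl.
Qed.

Definition letters (R : pzRingType) : series {fmonom nat} R := fun w =>
  (size w == 1)%:R.

Lemma ev_letters0 : ev (letters rat) 0%N = 0.
Proof. by rewrite /ev big_seq1 rmorph0 mul0r. Qed.

Lemma ev_lettersS m : ev (letters rat) m.+1 = a m.
Proof.
rewrite /ev (bigD1_seq (FMonom [:: m])) ?all_words_uniq //=; last first.
  by rewrite mem_all_words /weight /= addn0.
rewrite big_seq1 rmorph1 mul1r big_seq_cond big1 ?addr0 // => -[w].
rewrite mem_all_words /letters => /andP[/eqP]; case: w => [|k [|l w]] //=;
  last first.
  by rewrite rmorph0 mul0r.
by rewrite /weight /= addn0 => -[->]; rewrite eqxx.
Qed.

(** The sum of all letters evaluates to t h(t). *)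
Lemma mul_ev_letters (e : tseries A) m : (e * ev (letters rat)) m.+1 =
  (e * a) m.
Proof.
rewrite !tseries_mulE big_ord_recr /= subnn ev_letters0 mulr0 addr0.
by apply: eq_bigr => i _; rewrite subSn ?ev_lettersS // -ltnS.
Qed.

End Evaluation.

(** The equation determines each coefficient from the preceding ones. *)
Lemma flow_unique (K : comAlgType rat) (V : lmodType K)
  (h e1 e2 : tseries (linop V)) :
  e1 0%N = e2 0%N ->
  (forall m, e1 m.+1 *+ m.+1 = (e1 * h) m) ->
  (forall m, e2 m.+1 *+ m.+1 = (e2 * h) m) -> e1 = e2.
Proof.
move=> eq0 eq1 eq2; apply/funext => m; elim/ltn_ind: m => -[|m] // IHm.
apply: (@linop_mulrnI _ _ m); rewrite eq1 eq2 !tseries_mulE.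
by apply: eq_bigr => i _; rewrite IHm.
Qed.

(** * Exponential and logarithm in word series *)

Section WordSeries.
Variable R : nzRingType.
Local Notation WS := (series {fmonom nat} R).
Implicit Types (f g : WS) (w : seq nat).

Lemma word_mulE f g w : (f * g) (FMonom w) =
  \sum_(i < (size w).+1) f (FMonom (take i w)) * g (FMonom (drop i w)).
Proof. by rewrite series_mulE big_map big_iota. Qed.

Lemma word_oneE w : (1 : WS) (FMonom w) = (w == [::])%:R.
Proof. by rewrite series_oneE (_ : mone = FMonom [::]) //; apply: fmoneE. Qed.

Lemma letters_mul f w :
  (letters R * f) (FMonom w) = if w is _ :: w' then f (FMonom w') else 0.
Proof.
rewrite word_mulE; case: w => [|k w]; first by rewrite big_ord1 mul0r.
rewrite big_ord_recl mul0r add0r big_ord_recl /= take0 drop0 /letters /= mul1r.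
rewrite big1 ?addr0 // => i _.
by rewrite [size _]size_takel ?mul0r //; apply: (ltn_ord i).
Qed.

Lemma mul_letters f w k : (f * letters R) (FMonom (rcons w k)) = f (FMonom w).
Proof.
rewrite word_mulE size_rcons big_ord_recr big_ord_recr /= big1 => [|i _].
  rewrite add0r /= [drop (size w).+1 _]drop_oversize ?size_rcons //.
  rewrite /letters mulr0 addr0 /=.
  by rewrite -cats1 take_size_cat // drop_size_cat // mulr1.
rewrite /letters /= size_drop size_rcons.
by rewrite subSn 1?ltnW // eqSS subn_eq0 leqNgt ltn_ord mulr0.
Qed.

(** The order filtration by length of words, which makes truncated sums
    exact. *)
Definition vanish n f := forall w, (size w < n)%N -> f (FMonom w) = 0.

Lemma vanish_mul m n f g : vanish m f -> vanish n g -> vanish (m + n) (f * g).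
Proof.
move=> f_m g_n w lt_w; rewrite word_mulE big1 // => i _.
have le_iw : (i <= size w)%N by rewrite -ltnS.
have [lt_im|le_mi] := ltnP i m; first by rewrite f_m ?mul0r ?size_takel.
rewrite [g _]g_n ?mulr0 // size_drop ltn_subLR // (leq_trans lt_w) //.
by rewrite leq_add2r.
Qed.

Lemma vanish_exp f k : vanish 1 f -> vanish k (f ^+ k).
Proof.
move=> f_1; elim: k => [|k IHk]; first by [].
by rewrite exprS -add1n; apply: vanish_mul.
Qed.

Lemma vanish_letters : vanish 1 (letters R).
Proof. by case. Qed.

Lemma letters_exp k w : (letters R ^+ k) (FMonom w) = (size w == k)%:R.
Proof.
elim: k w => [|k IHk] w; first by rewrite expr0 word_oneE size_eq0.
by rewrite exprS letters_mul; case: w.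
Qed.

End WordSeries.

Section WordLog.
Local Notation NS := (series {fmonom nat} rat).
Local Notation H := (letters rat).
Local Notation len := (fun w : {fmonom nat} => size w).
Local Notation D := (wder len).

(** The exponential of the sum X of all letters: X^k is the sum of all words
    of length k. *)
Definition exp_series : NS := fun w => (size w)`!%:R^-1.

Let lenM (u w : {fmonom nat}) : len (mmul u w) = (len u + len w)%N.
Proof. by rewrite /= fmM size_cat. Qed.

Lemma exp_series_comm : H * exp_series = exp_series * H.
Proof.
apply/funext => -[w]; rewrite letters_mul; case/lastP: w => [|w k].
  by rewrite word_mulE big_ord1 mulr0.
rewrite mul_letters /exp_series /=; case: w => //= l w.
by rewrite size_rcons.
Qed.

Lemma wder_exp_series : D exp_series = H * exp_series.
Proof.
apply/funext => -[w]; rewrite letters_mul /wder /exp_series /=.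
case: w => [|k w] /=; first by rewrite mulr0n.
rewrite -[LHS]mulr_natr factS natrM invfM mulrAC mulVf ?mul1r //.
by rewrite pnatr_eq0.
Qed.

(** The coefficients of log (1 + x); the one at k = 0 vanishes by the
    convention 0^-1 = 0. *)
Definition logc (k : nat) : rat := (-1) ^+ k.-1 / k%:R.

Lemma logc0 : logc 0 = 0.
Proof. by rewrite /logc invr0 mulr0. Qed.

(** The logarithm of 1 + U truncated at U^N, exact on words shorter than N
    when U has no constant term. *)
Definition log_sum N (U : NS) : NS := \sum_(k < N) logc k *: U ^+ k.

(** Let D multiply by the length, so that D U = X (1 + U) for U = e^X - 1.
    Since U commutes with X, D of the logarithm is the geometric sum of the
    (-U)^k times X (1 + U), that is X up to U^N; and D X = X. *)
Lemma log_exp_series N w : (size w < N)%N ->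
  log_sum N (exp_series - 1) (FMonom w) = H (FMonom w).
Proof.
case: N => // N; rewrite ltnS => le_wN; set U := exp_series - 1.
have U1 : vanish 1 U.
  by case=> // _;
    rewrite /U series_addE series_oppE word_oneE /exp_series /= subrr.
have DU : D U = H * (1 + U).
  by rewrite /U wderB wder1 // subr0 wder_exp_series addrC subrK.
have HU : GRing.comm U H.
  by rewrite /GRing.comm /U mulrBl mulrBr -exp_series_comm mulr1 mul1r.
(* The power rule needs that U commutes with D U. *)
have D_exp k : D (U ^+ k.+1) = (U ^+ k * D U) *+ k.+1.
  elim: k => [|k IHk]; first by rewrite expr1 mul1r.
  have DUU : GRing.comm (D U) U.
    apply: commr_sym; rewrite DU; apply: commrM => //.
    by apply: commrD => //; apply: commr1.
  rewrite exprS wderM // IHk mulrnAr mulrA -exprS -(commrX k.+1 DUU).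
  by rewrite -mulrS.
have signE k (x : NS) : (-1) ^+ k *: x = (-1) ^+ k * x.
  elim: k => [|k IHk]; first by rewrite scale1r mul1r.
  by rewrite !exprS -scalerA IHk scaleN1r mulN1r mulNr.
have DL : D (log_sum N.+1 U) = H * (1 - (- U) ^+ N).
  rewrite /log_sum big_ord_recl /= logc0 scale0r add0r.
  rewrite (big_morph _ (@wderD _ _ _) (@wder0 _ _ _)).
  transitivity (\sum_(k < N) H * (- U) ^+ k * (1 + U)).
    apply: eq_bigr => k _; rewrite wderZ D_exp DU /logc /= -scaler_nat scalerA.
    rewrite divfK ?pnatr_eq0 // (exprNn U) signE !mulrA (commr_sign H k).
    by rewrite -(mulrA _ _ H) -(commrX k (commr_sym HU)) !mulrA.
  rewrite -mulr_suml -mulr_sumr -mulrA; congr (_ * _).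
  have -> : (\sum_(k < N) (- U) ^+ k) * (1 + U) =
    (1 + U) * \sum_(k < N) (- U) ^+ k.
    apply: commr_sym; apply: commr_sum => k _; apply: commrX.
    by apply: commrN; apply: commr_sym; apply: commrD; [apply: commr1|].
  by rewrite -(opprB _ 1) subrX1 -mulNr (opprB (- U) 1) opprK.
have := congr1 (fun f : NS => f (FMonom w)) DL.
rewrite mulrBr mulr1 [RHS]series_addE series_oppE.
have HU_N : vanish N.+1 (H * (- U) ^+ N).
  rewrite -add1n; apply: vanish_mul; first exact: vanish_letters.
  by apply: vanish_exp => x x0; rewrite series_oppE U1 ?oppr0.
rewrite HU_N // subr0 /wder /=.
have [sz_w|] := posnP (size w); last first.
  rewrite /letters /=; case: (size w) => [|[|m]] // _.
  by move=> /eqP; rewrite -[_ *+ m.+2]mulr_natr mulf_eq0 pnatr_eq0 orbF => /eqP.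
rewrite (size0nil sz_w) => _; rewrite /log_sum series_sumE big1 // =>
  -[[|k] ltk] _.
  by rewrite logc0 scale0r.
by rewrite series_scaleE (@vanish_exp _ _ k.+1 U1) ?mulr0.
Qed.

Lemma exp_series_sum N w : (size w < N)%N ->
  exp_series (FMonom w) = (\sum_(k < N) k`!%:R^-1 *: H ^+ k) (FMonom w).
Proof.
move=> lt_wN; rewrite series_sumE (bigD1 (Ordinal lt_wN)) //= big1 =>
  [|k neq_k].
  by rewrite series_scaleE letters_exp eqxx mulr1 addr0.
rewrite series_scaleE letters_exp; case: eqP => [eq_k|_]; last by rewrite mulr0.
by case/eqP: neq_k; apply: val_inj.
Qed.

End WordLog.

Section TexpLog.
Variables (K : comAlgType rat) (v : var_kind) (n : nat).
Local Notation A := (linop (zseries v n K)).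
Local Notation q := (@qop K (zseries v n K)).
Variable d : tseries A.
Hypothesis d0 : d 0%N = 0.
Local Notation ev_d := (ev (fun k => d k.+1)).

Lemma ev_letters_shift : ev_d (letters rat) = d.
Proof.
by apply/funext => -[|m]; [rewrite ev_letters0 d0 | rewrite ev_lettersS].
Qed.

(** Letters are evaluated at the coefficients of d, shifted because d has no
    constant term. *)
Lemma texp_ev : texp d = ev_d exp_series.
Proof.
apply/funext => m; rewrite /texp.
rewrite (@eq_ev _ _ _ _ _ (\sum_(k < m.+1) k`!%:R^-1 *: letters rat ^+ k)).
  rewrite ev_sum !series_sumE; apply: eq_bigr => k _.
  by rewrite evZ evX ev_letters_shift.
by case=> w /= def_m; apply: exp_series_sum; rewrite ltnS -def_m size_le_weight.
Qed.

(** The transport of log (exp X) = X along the evaluation that sends X to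
    d. *)
Lemma log_texp m : d m = (\sum_(k < m.+1) q (logc k) *: (texp d - 1) ^+ k) m.
Proof.
rewrite -{1}ev_letters_shift (@eq_ev _ _ _ _ _ (log_sum m.+1 (exp_series - 1))).
  rewrite ev_sum !series_sumE; apply: eq_bigr => k _.
  by rewrite evZ evX evD evN ev1 -texp_ev.
case=> w /= def_m; rewrite log_exp_series // ltnS -def_m.
exact: size_le_weight.
Qed.

End TexpLog.

(** * The universal solution of the differential equation *)

(** The iterated integral of t_1^(k_1) ... t_r^(k_r) over 0 < t_1 < ... < t_r
    < 1: the exponent reached after integrating the first i variables is the
    weight of the first i letters. *)
Definition flow_coef (w : seq nat) : rat :=
  \prod_(i < size w) (weight (take i.+1 w))%:R^-1.

Definition flow_series : series {fmonom nat} rat := fun w => flow_coef w.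

Lemma flow_coef_rcons w k :
  flow_coef (rcons w k) = flow_coef w / (weight (rcons w k))%:R.
Proof.
rewrite /flow_coef size_rcons big_ord_recr /= [take (size w).+1 _]take_oversize
  ?size_rcons //.
congr (_ * _); apply: eq_bigr => i _.
by rewrite -cats1 takel_cat.
Qed.

(** The counterpart of dE/dt = E h. *)
Lemma wder_flow_series :
  wder (weight : {fmonom nat} -> nat) flow_series = flow_series * letters rat.
Proof.
apply/funext => -[w]; rewrite /wder /=; case/lastP: w => [|w k].
  by rewrite word_mulE big_ord1 mulr0 mulr0n.
rewrite mul_letters /flow_series /= flow_coef_rcons -[LHS]mulr_natr divfK //.
by rewrite pnatr_eq0 -cats1 weight_cat /weight /= addn0 addnS.
Qed.

Lemma texp_flow (K : comAlgType rat) (v : var_kind) (n : nat)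
    (d h : tseries (linop (zseries v n K))) :
  (forall m, texp d m.+1 *+ m.+1 = (texp d * h) m) -> texp d = ev h flow_series.
Proof.
move=> ode; apply: (flow_unique _ ode).
  rewrite /texp big_ord1 expr0 series_scaleE /ev big_seq1 big_nil /flow_series.
  by rewrite /flow_coef /= big_ord0 fact0 invr1.
move=> m; rewrite -ev_wder wder_flow_series evM mul_ev_letters.
by [].
Qed.

(** * Orderings of the letters of a word *)

(** Lists of positions record an ordering, the earlier entries carrying the
    later times. This counts the p such that p + 1 comes after p. *)
Fixpoint succ_after (l : seq nat) : nat :=
  if l is p :: l' then ((p.+1 \in l') + succ_after l')%N else 0%N.

(** The number of p such that p comes after p + 1. *)
Fixpoint pred_after (l : seq nat) : nat :=
  if l is p :: l' then ((p \in map succn l') + pred_after l')%N else 0%N.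

(** The iterated integral of t_1^(k_1) ... t_r^(k_r) over 1 > t_1 > ... > t_r
    > 0, as the innermost variable is the last one. *)
Fixpoint simplex_coef (w : seq nat) : rat :=
  if w is _ :: w' then (weight w)%:R^-1 * simplex_coef w' else 1.

Lemma perm_weight u w : perm_eq u w -> weight u = weight w.
Proof. by move=> eq_uw; rewrite /weight !sumnE; apply/perm_big/perm_map. Qed.

Lemma rem_cat p (s1 s2 : seq nat) :
  rem p (s1 ++ s2) = if p \in s1 then rem p s1 ++ s2 else s1 ++ rem p s2.
Proof.
elim: s1 => //= k s1 IHs; rewrite inE [k == p]eq_sym.
by case: eqP => //= _; rewrite IHs; case: ifP.
Qed.

Section FillingSums.
Variables (T : comAlgType rat) (x y : T).
Implicit Types (a : nat -> nat) (s l : seq nat) (p : nat).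

Definition filling_weight a l : T :=
  simplex_coef (map a l) *: (x ^+ succ_after l * y ^+ pred_after l).

(** The sum of the simplex coefficients over all orders in which the positions
    of s may be filled, with a factor x (resp. y) for each position filled
    while its right (resp. left) neighbour is still empty. *)
Definition filling_sum a s : T := \sum_(l <- permutations s) filling_weight a l.

Lemma filling_sum_nil a : filling_sum a [::] = 1.
Proof. by rewrite /filling_sum big_seq1 /filling_weight scale1r !expr0 mulr1.
  Qed.

Lemma eq_filling_sum a b s :
  {in s, a =1 b} -> filling_sum a s = filling_sum b s.
Proof.
move=> eq_ab; apply: eq_big_seq => l; rewrite mem_permutations => eq_ls.
rewrite /filling_weight (_ : map a l = map b l) //; apply/eq_in_map => p.
by rewrite (perm_mem eq_ls); apply: eq_ab.
Qed.

(** Split according to the position filled at first. The weight removed from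
    the simplex coefficient is the total weight, whatever this position is. *)
Lemma filling_sum_rec a s : uniq s ->
  (weight (map a s))%:R *: filling_sum a s =
  \sum_(p <- s) x ^+ (p.+1 \in s) * y ^+ (p \in map succn s) * filling_sum a
    (rem p s).
Proof.
move=> s_uniq; have [s0|s_gt0] := posnP (size s).
  by rewrite (size0nil s0) scale0r big_nil.
rewrite /filling_sum (perm_big _ (permutationsE s_gt0)) big_allpairs_dep
  undup_id //=.
rewrite scaler_sumr; apply: eq_big_seq => p s_p.
rewrite scaler_sumr mulr_sumr; apply: eq_big_seq => l;
  rewrite mem_permutations => eq_l.
have eq_pl: perm_eq (p :: l) s.
  by rewrite perm_sym (permPl (perm_to_rem s_p)) perm_cons perm_sym.
rewrite /filling_weight [succ_after _]/= [pred_after _]/= [simplex_coef _]/=.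
have -> : (weight (a p :: map a l)) = weight (map a s).
  by apply: perm_weight; apply: (perm_map a eq_pl).
have w_neq0 : (weight (map a s))%:R != 0 :> rat.
  by rewrite pnatr_eq0 -lt0n (leq_trans _ (size_le_weight _)) ?size_map.
rewrite scalerA mulrA divff // mul1r -scalerAr; congr (_ *: _).
have -> : (p.+1 \in s) = (p.+1 \in l).
  by rewrite -(perm_mem eq_pl) inE gtn_eqF.
have -> : (p \in map succn s) = (p \in map succn l).
  by rewrite -(perm_mem (perm_map succn eq_pl)) inE ltn_eqF.
by rewrite !exprD mulrACA.
Qed.

(** The shuffle identity: sets of positions without contact are filled
    independently of each other. By induction on the size, both sides
    satisfying the same recursion, since a position of s1 has no neighbour in
    s2. *)
Lemma filling_sum_cat a s1 s2 :
  uniq (s1 ++ s2) ->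
  {in s1 & s2, forall p q, (p.+1 != q) && (q.+1 != p)} ->
  filling_sum a (s1 ++ s2) = filling_sum a s1 * filling_sum a s2.
Proof.
move: {2}(size _) (leqnn (size (s1 ++ s2))) => n.
elim: n s1 s2 => [|n IHn] s1 s2.
  by case: s1 => [|p s1] //; case: s2 => //= _ _ _;
    rewrite filling_sum_nil mulr1.
move=> le_n s_uniq s_sep.
have [s0|s_gt0] := posnP (size (s1 ++ s2)).
  move/size0nil: s0; case: (s1) => [|//]; case: (s2) => //= _.
  by rewrite filling_sum_nil mulr1.
have w_neq0 : (weight (map a (s1 ++ s2)))%:R != 0 :> rat.
  by rewrite pnatr_eq0 -lt0n (leq_trans _ (size_le_weight _)) ?size_map.
apply: (scalerI w_neq0);
  rewrite filling_sum_rec // (map_cat a) weight_cat natrD scalerDl.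
move: (s_uniq); rewrite cat_uniq => /and3P[s1_uniq s12 s2_uniq].
have rem_sep t1 t2 p : perm_eq (t1 ++ t2) (rem p (s1 ++ s2)) ->
  p \in s1 ++ s2 ->
    {subset t1 <= s1} -> {subset t2 <= s2} ->
    filling_sum a (t1 ++ t2) = filling_sum a t1 * filling_sum a t2.
  move=> eq_t s_p t_s1 t_s2; apply: IHn.
  - by rewrite (perm_size eq_t) size_rem // -ltnS prednK.
  - by rewrite (perm_uniq eq_t) rem_uniq.
  - by move=> i j /t_s1 s1i /t_s2 s2j; apply: s_sep.
rewrite [in RHS]scalerAl [X in _ + X]scalerAr !filling_sum_rec //.
rewrite big_cat mulr_suml mulr_sumr /=.
congr (_ + _); apply: eq_big_seq => p s_p.
  have p12 : p \in s1 ++ s2 by rewrite mem_cat s_p.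
  rewrite rem_cat s_p (rem_sep _ _ p) ?rem_cat ?s_p //; last exact: mem_rem.
  rewrite mulrA; congr (_ ^+ nat_of_bool _ * _ ^+ nat_of_bool _ * _ * _).
    rewrite mem_cat; case: (boolP (p.+1 \in s2)) => [s2p|];
      last by rewrite orbF.
    by have := s_sep _ _ s_p s2p; rewrite eqxx.
  rewrite map_cat mem_cat; case: (boolP (p \in map succn s2));
    last by rewrite orbF.
  by move=> /mapP[q s2q def_p]; have := s_sep _ _ s_p s2q;
    rewrite def_p eqxx andbF.
have p12 : p \in s1 ++ s2 by rewrite mem_cat s_p orbT.
have s1p : p \in s1 = false.
  by apply/negbTE; apply: contra s12 => s1p; apply/hasP; exists p.
rewrite rem_cat s1p (rem_sep _ _ p) ?rem_cat ?s1p //; last exact: mem_rem.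
rewrite [RHS]mulrCA; congr (_ ^+ nat_of_bool _ * _ ^+ nat_of_bool _ * _).
  rewrite mem_cat; case: (boolP (p.+1 \in s1)) => [s1p1|//].
  by have := s_sep _ _ s1p1 s_p; rewrite eqxx andbF.
rewrite map_cat mem_cat; case: (boolP (p \in map succn s1)) =>
  // /mapP[q s1q def_p].
by have := s_sep _ _ s1q s_p; rewrite def_p eqxx.
Qed.

Lemma filling_sum_shift a k s : uniq s ->
  filling_sum a (map (addn k) s) = filling_sum (a \o addn k) s.
Proof.
move: {2}(size s) (leqnn (size s)) => n.
elim: n s => [|n IHn] s; first by case: s => //= _ _; rewrite !filling_sum_nil.
move=> le_n s_uniq.
have [s0|s_gt0] := posnP (size s);
  first by rewrite (size0nil s0) !filling_sum_nil.
have ks_uniq : uniq (map (addn k) s) by rewrite map_inj_uniq //; apply: addnI.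
have w_neq0 : (weight (map (a \o addn k) s))%:R != 0 :> rat.
  by rewrite pnatr_eq0 -lt0n (leq_trans _ (size_le_weight _)) ?size_map.
apply: (scalerI w_neq0); rewrite filling_sum_rec // map_comp filling_sum_rec //.
rewrite big_map; apply: eq_big_seq => p s_p.
have -> : (k + p).+1 \in map (addn k) s = (p.+1 \in s).
  by rewrite -addnS mem_map //; apply: addnI.
have -> : (k + p)%N \in map succn (map (addn k) s) = (p \in map succn s).
  rewrite -map_comp (eq_map (_ : succn \o addn k =1 addn k \o succn)) =>
    [|i /=].
    by rewrite map_comp mem_map //; apply: addnI.
  by rewrite addnS.
congr (_ * _); rewrite -IHn ?rem_uniq //;
  last by rewrite size_rem // -ltnS prednK.
congr filling_sum; rewrite !rem_filter // filter_map; congr map.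
by apply: eq_filter => i /=; rewrite eqn_add2l.
Qed.

End FillingSums.

(** Every adjacent pair is counted by exactly one of the two statistics. *)
Lemma succ_pred_after l : uniq l ->
  (succ_after l + pred_after l)%N = count (fun p => p.+1 \in l) l.
Proof.
elim: l => //= p l IHl /andP[pl l_uniq].
rewrite addnACA IHl // inE gtn_eqF //= -addnA; congr (_ + _)%N.
have -> : (p \in map succn l) = count (preim succn (pred1 p)) l :> nat.
  by rewrite -count_map count_uniq_mem // map_inj_uniq //; apply: succn_inj.
rewrite -count_predUI [X in (_ + X)%N](_ : _ = 0%N) ?addn0.
  by apply: eq_count => q; rewrite /= inE.
apply/eqP; rewrite -leqn0 leqNgt -has_count; apply/hasPn => q lq /=.
by case: eqP => //= ->.
Qed.

Lemma succ_pred_after_iota r l : perm_eq l (iota 0 r) ->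
  (succ_after l + pred_after l)%N = r.-1.
Proof.
move=> eq_l; have l_uniq : uniq l by rewrite (perm_uniq eq_l) iota_uniq.
rewrite succ_pred_after //; have /seq.permP-> := eq_l;
  rewrite (eq_in_count (a2 := fun p => p < r.-1)%N).
  case: r {eq_l} => // r;
    rewrite -[X in iota 0 X]addn1 iotaD count_cat /= add0n ltnn !addn0.
  rewrite (eq_in_count (a2 := predT)) ?count_predT ?size_iota // => p.
  by rewrite mem_iota.
by move=> p _; rewrite (perm_mem eq_l) mem_iota add0n; case: r {eq_l}.
Qed.

(** * The resolvent of the universal solution *)

Section OrderSeries.
Variables (T : comAlgType rat) (x : T).
Local Notation y := (1 + x).
Local Notation WS := (series {fmonom nat} T).
Local Notation H := (letters T).
Local Notation D := (wder (weight : {fmonom nat} -> nat)).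

Definition order_coef (w : seq nat) : T :=
  if w is [::] then 1 else x * filling_sum x y (nth 0%N w) (iota 0 (size w)).

(** It will turn out to be the resolvent (1 - x (E - 1))^-1. *)
Definition order_series : WS := fun w => order_coef w.

(** The differential equation of the resolvent: filling position p at first
    leaves the two intervals on either side, and the neighbours of p bring a
    factor y if the left one is nonempty, x if the right one is. *)
Lemma wder_order_series :
  D order_series = (y *: order_series - 1) * (H * order_series).
Proof.
apply/funext => -[w];
  rewrite word_mulE big_ord_recr /= drop_size letters_mul mulr0 addr0.
have [w0|w_gt0] := posnP (size w).
  by rewrite w0 big_ord0 /wder /= (size0nil w0) mulr0n.
rewrite /wder.
have -> : order_series (FMonom w) =
  x * filling_sum x y (nth 0%N w) (iota 0 (size w)).
  by rewrite /order_series /=; case: w w_gt0.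
rewrite -mulrnAr -scaler_nat -{1}(mkseq_nth 0%N w) filling_sum_rec ?iota_uniq
  //.
rewrite mulr_sumr big_iota.
apply: eq_bigr => p _; have lt_pw := ltn_ord p.
rewrite (drop_nth 0%N) // letters_mul series_addE series_oppE word_oneE.
have iota_p : iota 0 (size w) =
  iota 0 p ++ (p : nat) :: iota p.+1 (size w - p.+1).
  by rewrite -[in LHS](subnKC lt_pw) addSnnS iotaD.
have p_iota : (p : nat) \notin iota 0 p by rewrite mem_iota ltnn.
have -> : rem (p : nat) (iota 0 (size w)) =
  iota 0 p ++ iota p.+1 (size w - p.+1).
  by rewrite iota_p rem_cat (negPf p_iota) /= eqxx.
rewrite filling_sum_cat; last 2 first.
- have := iota_uniq 0 (size w); rewrite iota_p.
  by apply: subseq_uniq; apply: cat_subseq => //; apply: subseq_cons.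
- move=> i j; rewrite !mem_iota => lt_i lt_j; apply/andP; split; lia.
have -> : filling_sum x y (nth 0%N w) (iota 0 p) =
          filling_sum x y (nth 0%N (take p w)) (iota 0 (size (take p w))).
  rewrite size_takel 1?ltnW //.
  by apply: eq_filling_sum => i; rewrite mem_iota => /andP[_ lt_ip];
    rewrite nth_take.
have -> : filling_sum x y (nth 0%N w) (iota p.+1 (size w - p.+1)) =
          filling_sum x y (nth 0%N (drop p.+1 w)) (iota 0 (size (drop p.+1 w))).
  rewrite size_drop.
  rewrite -{1}[p.+1]addn0 iotaDl filling_sum_shift ?iota_uniq //.
  by apply: eq_filling_sum => i _; rewrite /= nth_drop.
have -> : (p.+1 \in iota 0 (size w)) = (size (drop p.+1 w) != 0%N).
  by rewrite mem_iota size_drop subn_eq0 -ltnNge.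
have -> : ((p : nat) \in map succn (iota 0 (size w))) =
  (size (take p w) != 0%N).
  rewrite (size_takel (ltnW lt_pw)) -(iotaDl 1 0) mem_iota.
  by rewrite addn0 lt0n (leq_trans lt_pw) ?leq_addl ?andbT.
rewrite series_scaleE /order_series /order_coef /=.
case: (take p w) => [|k u]; case: (drop p.+1 w) => [|l t] //=.
- by rewrite !filling_sum_nil !expr0 /=; ring.
- by rewrite filling_sum_nil expr0 expr1 /=; ring.
- by rewrite filling_sum_nil expr0 expr1 /=; ring.
- by rewrite !expr1; ring.
Qed.

Definition flow_series_in : WS := fun w => (flow_coef w)%:A.

Let DM (f g : WS) : D (f * g) = D f * g + f * D g.
Proof. by apply: wderM => u w; rewrite /= fmM weight_cat. Qed.

(** Put B = 1 - x (E - 1) and Q = O B - 1. The equations of O and E give D Q =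
    (y O - 1) X Q + Q X, where each term on the right involves Q on strictly
    shorter words only; so Q = 0 by induction on the length. *)
Lemma order_series_resolvent : order_series * (1 - x *: (flow_series_in - 1)) =
  1.
Proof.
set U := flow_series_in - 1; set B := 1 - x *: U; set O := order_series.
set Q := O * B - 1.
have DE : D flow_series_in = flow_series_in * H.
  apply/funext => -[w]; have :=
    congr1 (fun f : series {fmonom nat} rat => f (FMonom w)) wder_flow_series.
  case/lastP: w => [|w k]; first by move=> _;
    rewrite word_mulE big_ord1 mulr0 /wder mulr0n.
  by rewrite !mul_letters /wder /flow_series /flow_series_in /= => <-;
    rewrite scalerMnl.
have D1 : D (1 : WS) = 0 by rewrite wder1 // => u w; rewrite /= fmM weight_cat.
have DB : D B = B * H - y *: H.
  rewrite /B wderB D1 wderZ /U wderB D1 subr0 DE sub0r.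
  rewrite mulrBl mul1r -scalerAl mulrBl mul1r scalerBr scalerDl scale1r.
  by rewrite opprB opprD [RHS]addrACA subrr add0r addrAC subrr add0r.
have DQ : D Q = (y *: O - 1) * (H * Q) + Q * H.
  rewrite /Q wderB D1 subr0 DM wder_order_series DB -/O.
  have : (y *: O - 1) * H = y *: (O * H) - H by rewrite mulrBl mul1r scalerAl.
  move: (y *: O - 1) => X XH.
  rewrite (mulrBr H) mulr1 (mulrBr X) [(_ - 1) * H]mulrBl mul1r (mulrBr O) XH
    -scalerAr !mulrA.
  by rewrite opprB -!addrA; congr (_ + _);
    rewrite [RHS]addrC -!addrA addNr addr0 addrC.
have Q_vanish n : vanish n Q.
  elim: n => // n IHn w lt_w.
  have [w0|w_gt0] := posnP (size w).
    rewrite (size0nil w0) /Q series_addE series_oppE word_oneE word_mulE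
      big_ord1 /=.
    rewrite {1}/O /order_series /= mul1r /B series_addE series_oppE
      series_scaleE.
    rewrite /U series_addE series_oppE word_oneE /flow_series_in /flow_coef /=
      big_ord0.
    by rewrite scale1r subrr mulr0 subr0 subrr.
  have : D Q (FMonom w) = 0.
    rewrite DQ series_addE.
    rewrite (@vanish_mul _ 0 n.+1 _ _ _ _ w) // ?add0r.
      rewrite (@vanish_mul _ n 1 _ _ IHn (@vanish_letters _)) //.
      by rewrite addn1.
    by rewrite -add1n; apply: vanish_mul => //; apply: vanish_letters.
  rewrite /wder -scaler_nat => /eqP;
    rewrite scaler_eq0 pnatr_eq0 => /orP[|/eqP //].
  by rewrite -leqn0 leqNgt (leq_trans w_gt0) // size_le_weight.
apply/eqP; rewrite -subr_eq0; apply/eqP/funext => -[w].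
by apply: (Q_vanish (size w).+1).
Qed.

(** The geometric series of the resolvent, up to a remainder that vanishes on
    words shorter than N. *)
Lemma order_coef_expansion N w : (size w < N)%N ->
  order_coef w = \sum_(k < N) x ^+ k * (((flow_series - 1) ^+ k) (FMonom w))%:A.
Proof.
move=> lt_wN; set U := flow_series_in - 1.
have expansion n : order_series =
  \sum_(k < n) x ^+ k *: U ^+ k + x ^+ n *: (order_series * U ^+ n).
  elim: n => [|n IHn]; first by rewrite big_ord0 add0r scale1r mulr1.
  rewrite {1}IHn big_ord_recr /= -addrA; congr (_ + _).
  have O_rec : order_series = 1 + x *: (order_series * U).
    have := order_series_resolvent; rewrite mulrBr mulr1 -scalerAr => /eqP.
    by rewrite subr_eq => /eqP.
  rewrite {1}O_rec mulrDl mul1r scalerDr; congr (_ + _).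
  by rewrite -scalerAl scalerA -exprSr (exprS U) mulrA.
have U1 : vanish 1 U.
  case=> // _; rewrite /U series_addE series_oppE word_oneE /flow_series_in.
  by rewrite /flow_coef big_ord0 scale1r subrr.
have mapU k u : (U ^+ k) (FMonom u) = (((flow_series - 1) ^+ k) (FMonom u))%:A.
  have natA b : (nat_of_bool b)%:R = (b%:R : rat)%:A :> T.
    by case: b; rewrite ?scale1r ?scale0r.
  elim: k u => [|k IHk] u; first by rewrite !expr0 !word_oneE natA.
  rewrite !exprS !word_mulE scaler_suml; apply: eq_bigr => i _.
  rewrite IHk [U _](_ : _ = ((flow_series - 1) (FMonom (take i u)))%:A).
    by rewrite -scalerAl mul1r scalerA.
  by rewrite /U !series_addE !series_oppE !word_oneE natA scalerBl.
rewrite -[order_coef w]/(order_series (FMonom w)) (expansion N) series_addE.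
rewrite series_sumE series_scaleE
  (@vanish_mul _ 0 N _ _ _ (@vanish_exp _ _ N U1)) // mulr0 addr0.
by apply: eq_bigr => k _; rewrite series_scaleE mapU.
Qed.
End OrderSeries.

(** * From the resolvent to the logarithm *)

(** The integral of x^a (1 + x)^b from -1 to 0. *)
Definition beta_coef (a b : nat) : rat :=
  (-1) ^+ a * (a`! * b`!)%:R / (a + b).+1`!%:R.

Lemma beta_coefS a b : beta_coef a b.+1 = beta_coef a b + beta_coef a.+1 b.
Proof.
rewrite /beta_coef addnS addSn (factS (a + b).+1) (factS a) (factS b) exprS.
move: ((a + b).+1)`! (fact_gt0 (a + b).+1) => f f_gt0; rewrite !natrM.
have f_neq0 : (f%:R : rat) != 0 by rewrite pnatr_eq0 -lt0n.
have : ((a + b).+2%:R : rat) != 0 by rewrite pnatr_eq0.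
rewrite -[(a + b).+2]addn2 -[a.+1]addn1 -[b.+1]addn1 !natrD => n_neq0.
by field; rewrite n_neq0 f_neq0.
Qed.

(** Integration of p(x)/x from -1 to 0, on polynomials of degree less than N
    without constant term. *)
Definition log_functional N (p : {poly rat}) : rat :=
  \sum_(k < N) logc k * p`_k.

Lemma log_functionalD N p p' :
  log_functional N (p + p') = log_functional N p + log_functional N p'.
Proof. by rewrite -big_split; apply: eq_bigr => k _; rewrite coefD mulrDr. Qed.

Lemma log_functionalZ N c p : log_functional N (c *: p) =
  c * log_functional N p.
Proof. by rewrite mulr_sumr; apply: eq_bigr => k _; rewrite coefZ mulrCA. Qed.

Lemma log_functional_sum N I (s : seq I) (F : I -> {poly rat}) :
  log_functional N (\sum_(i <- s) F i) = \sum_(i <- s) log_functional N (F i).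
Proof.
apply: (big_morph _ (log_functionalD N)).
by rewrite /log_functional big1 // => k _; rewrite coef0 mulr0.
Qed.

Lemma log_functionalXn N k : (k < N)%N -> log_functional N 'X^k = logc k.
Proof.
move=> lt_kN;
  rewrite /log_functional (bigD1 (Ordinal lt_kN)) //= coefXn eqxx mulr1.
rewrite big1 ?addr0 // => j neq_jk; rewrite coefXn.
by case: eqP => [eq_jk|]; rewrite ?mulr0 //; case/eqP: neq_jk; apply: val_inj.
Qed.

(** Both sides obey Pascal's rule in b, from x^a (1 + x)^(b+1) = x^a (1 + x)^b
    + x^(a+1) (1 + x)^b. *)
Lemma log_functional_beta N a b : (a + b < N.-1)%N ->
  log_functional N ('X ^+ a.+1 * (1 + 'X) ^+ b) = beta_coef a b.
Proof.
elim: b a => [|b IHb] a lt_N.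
  rewrite expr0 mulr1 log_functionalXn; last by lia.
  rewrite /logc /beta_coef addn0 muln1 factS natrM /=.
  have f_neq0 : (a`!%:R : rat) != 0 by rewrite pnatr_eq0 -lt0n fact_gt0.
  by rewrite invfM [_^-1 * _^-1]mulrC mulrA mulfK.
rewrite (exprS (1 + 'X)) mulrA mulrDr mulr1 -exprSr mulrDl log_functionalD.
by rewrite beta_coefS !IHb //; lia.
Qed.

(** Apply the functional to the two expressions of the resolvent. *)
Lemma log_flow_series N w : (0 < size w < N)%N ->
  log_sum N (flow_series - 1) (FMonom w) =
  \sum_(l <- permutations (iota 0 (size w)))
    simplex_coef (map (nth 0%N w) l) * beta_coef (succ_after l) (pred_after l).
Proof.
case/andP => w_gt0 lt_wN.
have := congr1 (log_functional N)
  (order_coef_expansion ('X : {poly rat}) lt_wN).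
rewrite log_functional_sum (eq_bigr (fun k : 'I_N =>
  (((flow_series - 1) ^+ k) (FMonom w)) * logc k)) => [|k _]; last first.
  by rewrite -scalerAr mulr1 log_functionalZ log_functionalXn.
rewrite /log_sum series_sumE => eq_log.
under eq_bigr do rewrite series_scaleE mulrC.
rewrite -eq_log /order_coef; case: (w) w_gt0 lt_wN => // k u _ lt_wN.
rewrite /filling_sum mulr_sumr log_functional_sum.
apply: eq_big_seq => l; rewrite mem_permutations => eq_l.
rewrite /filling_weight -scalerAr log_functionalZ mulrA -exprS.
rewrite log_functional_beta // (succ_pred_after_iota eq_l).
by case: N lt_wN {eq_log}.
Qed.

(** * Iterated integrals as sums over words *)

Section ExponentVectors.
Variable n : nat.

Definition expvec (s : seq nat) : {cmonom 'I_n} :=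
  [cmonom nth 0%N s (i : nat) | i in [fset j | j in 'I_n]%fset]%M.

Lemma expvecE s (i : 'I_n) : expvec s i = nth 0%N s i.
Proof. by rewrite cmE fsfun_fun ifT //; apply/imfsetP; exists i. Qed.

Lemma expcmn_ucmE (i j : 'I_n) b : expcmn (ucm i) b j = ((i == j) * b)%N.
Proof.
case: b => [|b]; first by rewrite onecmE muln0.
rewrite /expcmn iteropS; elim: b => [|b IHb] /=; first by rewrite ucmE muln1.
by rewrite mulcmE IHb ucmE -mulnS.
Qed.

End ExponentVectors.

Section IteratedIntegral.
Variables (K : comAlgType rat) (V : lmodType K) (r : nat).
Local Notation A := (linop V).
Local Notation q := (@qop K V).
Variable f : pseries r.+1 A.
Local Notation vec := (@expvec r.+1).

(** The integrals over t_(i+1), ..., t_r, which leave t_0, ..., t_i free. *)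
Definition inner_integral i : pseries r.+1 A :=
  foldr (fun j : 'I_r => integral (lift ord0 j) (widen_ord (leqnSn r) j))
    f (drop i (enum 'I_r)).

(** The primitive in t_(i+1) puts b + 1 in place of b and divides by it;
    substituting t_i then moves these b + 1 units of degree to t_i, so the
    coefficient at k in t_i collects all the splittings of k. *)
Lemma inner_integral_step u k (i : 'I_r) : size u = i ->
  inner_integral i (vec (rcons u k)) =
  \sum_(b < k) q (b.+1%:R^-1) *
    inner_integral i.+1 (vec (rcons (rcons u (k - b.+1)%N) b)).
Proof.
move=> sz_u; rewrite /inner_integral.
rewrite (drop_nth i) ?size_enum_ord // nth_ord_enum /=.
move: (foldr _ _ _) => g; rewrite /integral /set_param.
have ui (l : 'I_r.+1) : val l = i -> nth 0%N (rcons u k) l = k.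
  by move=> ->; rewrite nth_rcons sz_u ltnn eqxx.
rewrite expvecE nth_default ?size_rcons ?sz_u //= expvecE ui //.
have j_neq : (widen_ord (leqnSn r) i == lift ord0 i) = false.
  by apply/negbTE; rewrite -val_eqE /= /bump add1n ltn_eqF.
rewrite big_ord_recl /primitive.
rewrite cmM expcmn_ucmE muln0 addn0 divcmE expcmn_ucmE muln0 subn0 expvecE.
rewrite nth_default ?size_rcons ?sz_u // eqxx add0r.
apply: eq_bigr => b _; rewrite cmM expcmn_ucmE eqxx mul1n divcmE expcmn_ucmE.
rewrite j_neq mul0n subn0 expvecE nth_default ?size_rcons ?sz_u // add0n lift0
  (_ : (b.+1 == 0)%N = false) //.
congr (_ * g _); apply/eqP/cmP => l.
rewrite divcmE cmM divcmE !expcmn_ucmE ucmE !expvecE !nth_rcons size_rcons sz_u.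
have [<-|neq_l] := eqVneq (lift ord0 i) l.
  by rewrite j_neq lift0 ltnn eqxx ltnNge leqnSn /= gtn_eqF //=; lia.
have /negPf l_neq : (l : nat) != i.+1 by rewrite eq_sym -(lift0 i).
rewrite l_neq ltnS !mul0n addn0 subn0 -val_eqE /= eq_sym.
by case: (ltngtP l i) => //= _; rewrite ?mul0n ?mul1n ?subn0.
Qed.

Lemma words_recl (B : zmodType) s m (Phi : seq nat -> B) :
  \sum_(w <- words s.+1 m.+1) Phi w =
  \sum_(k < m.+1) \sum_(w <- words s (m - k)%N) Phi ((k : nat) :: w).
Proof.
by rewrite big_allpairs_dep big_iota.
Qed.

(** The exponents of t_i, ..., t_r form a word of weight k + 1: the last
    variables are integrated into t_i, and only t_i itself is not integrated,
    whence the extra 1. *)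
Lemma inner_integralE i u k : (i <= r)%N -> size u = i ->
  inner_integral i (vec (rcons u k)) =
  \sum_(w <- words (r - i).+1 k.+1) q (simplex_coef (behead w)) * f
    (vec (u ++ w)).
Proof.
move def_s: (r - i)%N => s; elim: s i u k def_s =>
  [|s IHs] i u k def_s le_ir sz_u.
  have -> : i = r by apply/eqP; rewrite eqn_leq le_ir -subn_eq0 def_s.
  rewrite words_recl big_ord_recr /= subnn big_seq1 rmorph1 mul1r cats1.
  rewrite big1 ?add0r => [|l _];
    last by rewrite subn_eq0 leqNgt ltn_ord big_nil.
  by rewrite /inner_integral drop_oversize ?size_enum_ord.
have lt_ir : (i < r)%N by rewrite -subn_gt0 def_s.
rewrite words_recl big_ord_recr /= subnn.
rewrite [X in _ + X](_ : _ = 0) ?addr0; last by rewrite big_nil.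
rewrite (@inner_integral_step u k (Ordinal lt_ir)) //
  [RHS](reindex_inj rev_ord_inj) /=.
apply: eq_bigr => b _.
rewrite IHs ?size_rcons ?sz_u //; last by rewrite subnS def_s.
rewrite subKn ?ltn_ord // mulr_sumr.
apply: eq_big_seq => w; rewrite mem_words => /andP[/eqP sz_w /eqP wt_w].
rewrite mulrA -rmorphM cat_rcons; congr (q _ * _).
by case: w sz_w wt_w => //= l w _ <-.
Qed.

Lemma iterated_integralE :
  (forall k : {cmonom 'I_r.+1}, k ord0 != 0%N -> f k = 0) ->
  forall m, iterated_integral f m =
  \sum_(w <- words r m) q (simplex_coef w) * f (vec (0%N :: w)).
Proof.
move=> f0 m; transitivity (inner_integral 0 (vec (rcons [::] m))).
  rewrite /inner_integral drop0 /iterated_integral; congr (_ _).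
  apply/eqP/cmP => l; rewrite expcmn_ucmE expvecE /=.
  case: (unliftP ord0 l) => [l'|] ->; last by rewrite mul1n.
  by rewrite -val_eqE lift0 /= nth_nil.
rewrite inner_integralE // subn0 words_recl big_ord_recl /= subn0.
rewrite [X in _ + X]big1 ?addr0 // => k _; rewrite big1 // => w _.
by rewrite f0 ?mulr0 // expvecE.
Qed.

End IteratedIntegral.

Section ParameterProduct.
Variables (K : comAlgType rat) (V : lmodType K) (n : nat)
  (h : tseries (linop V)).

(** Distinct parameters: each factor involves its own variable, so a monomial
    has only one factorization that contributes. *)
Lemma prod_at_param (J : seq 'I_n) (k : {cmonom 'I_n}) : uniq J ->
  (\prod_(j <- J) at_param j h) k =
  if [forall i, (i \notin J) ==> (k i == 0%N)] then \prod_(j <- J) h (k j) else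
    0.
Proof.
elim: J k => [|j J IHJ] k.
  move=> _; rewrite !big_nil series_oneE; case: forallP => [k0|k_neq0].
    suff -> : k = mone by rewrite eqxx.
    by apply/eqP/cmP => i; rewrite cm1; apply/eqP; apply: k0.
  case: eqP => // k1; case: k_neq0 => i; rewrite k1.
  by rewrite /= cm1.
move=> /= /andP[jJ J_uniq]; rewrite !big_cons series_mulE.
pose a := expcmn (ucm j) (k j).
have a_j : a j = k j by rewrite /a expcmn_ucmE eqxx mul1n.
have a_i i : i != j -> a i = 0%N.
  by rewrite /a expcmn_ucmE eq_sym => /negPf->.
transitivity (at_param j h a * (\prod_(i <- J) at_param i h) (divcm k a)).
  rewrite (bigD1_seq (a, divcm k a)) ?factors_uniq //; last first.
    rewrite mem_factors; apply/cmP => i; rewrite cmM divcmE.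
    have [->|/a_i ->] := eqVneq i j; last by rewrite subn0.
    by rewrite a_j subnn addn0.
  rewrite -[RHS]addr0; congr (_ + _); rewrite big_seq_cond big1 // => -[b c].
    rewrite mem_factors /= => /andP[/eqP def_k neq_ab].
    rewrite /at_param; case: ifP => [/forallP b0|_]; last by rewrite mul0r.
    rewrite IHJ //; case: ifP => [/forallP c0|_]; last by rewrite mulr0.
    case/eqP: neq_ab; have b_a : b = a.
      apply/eqP/cmP => i; have [->|neq_ij] := eqVneq i j.
        by rewrite a_j -def_k cmM (eqP (implyP (c0 j) jJ)) addn0.
      by rewrite a_i //; apply/eqP; apply: (implyP (b0 i)).
    by rewrite -b_a; congr pair; apply/eqP/cmP => i;
      rewrite divcmE -def_k cmM addKn.
rewrite /at_param ifT ?a_j; last first.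
  by apply/forallP => i; apply/implyP => /a_i ->.
rewrite IHJ //.
have c_j : divcm k a j = 0%N by rewrite divcmE a_j subnn.
have c_i i : i != j -> divcm k a i = k i by move=> neq_ij;
  rewrite divcmE a_i ?subn0.
have -> : [forall i, (i \notin J) ==> (divcm k a i == 0%N)] =
          [forall i, (i \notin j :: J) ==> (k i == 0%N)].
  apply: eq_forallb => i; rewrite inE; have [->|neq_ij] := eqVneq i j.
    by rewrite c_j eqxx implybT.
  by rewrite c_i.
case: ifP => _; last by rewrite mulr0.
congr (_ * _); apply: eq_big_seq => i J_i; rewrite c_i //.
by apply: contraNneq jJ => <-.
Qed.

End ParameterProduct.

(** * Permutations as orderings of positions *)

Lemma succ_after_index l : uniq l ->
  succ_after l = (\sum_(p <- l) ((p.+1 \in l) && (index p l < index p.+1 l)))%N.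
Proof.
elim: l => [|p l IHl] /=; first by rewrite big_nil.
case/andP=> pl l_uniq;
  rewrite big_cons IHl // eqxx inE gtn_eqF //= ltn_eqF //= andbT.
congr (_ + _)%N; apply: eq_big_seq => i li.
have -> : (p == i) = false by apply: contraNF pl => /eqP->.
rewrite inE; have [eq_p|neq_p] := eqVneq i.+1 p;
  first by rewrite eq_p ltn0 andbF (negPf pl).
by rewrite ltnS.
Qed.

Section TimeOrder.
Variable r : nat.
Implicit Types s : {perm 'I_r}.

(** The positions, from left to right in the product h(t_(s r)) ... h(t_(s
    1)), listed by decreasing time: entry i is the place where the parameter
    of index i occurs. *)
Definition time_order s : seq nat :=
  [seq (rev_ord (s^-1%g i) : nat) | i <- enum 'I_r].

Let time_pos_inj s : injective (fun i => rev_ord (s^-1%g i) : nat).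
Proof. by move=> i j /val_inj/rev_ord_inj/perm_inj. Qed.

Lemma size_time_order s : size (time_order s) = r.
Proof. by rewrite size_map size_enum_ord. Qed.

Lemma time_order_uniq s : uniq (time_order s).
Proof. by rewrite map_inj_uniq ?enum_uniq //; apply: time_pos_inj. Qed.

Lemma mem_time_order s p : (p \in time_order s) = (p < r)%N.
Proof.
apply/mapP/idP => [[i _ ->] //|lt_pr].
exists (s (rev_ord (Ordinal lt_pr))); first by rewrite mem_enum.
by rewrite permK rev_ordK.
Qed.

Lemma nth_time_order s (i : 'I_r) : nth 0%N (time_order s) i =
  rev_ord (s^-1%g i).
Proof. by rewrite (nth_map i) ?size_enum_ord // nth_ord_enum. Qed.

Lemma index_time_order s (i : 'I_r) : index (rev_ord i : nat) (time_order s) =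
  s i.
Proof.
rewrite -[X in rev_ord X](permK s) /time_order.
by rewrite (index_map (@time_pos_inj s) _ (s i)) index_enum_ord.
Qed.

Lemma perm_time_order s : perm_eq (time_order s) (iota 0 r).
Proof.
apply: uniq_perm; rewrite ?time_order_uniq ?iota_uniq // => p.
by rewrite mem_time_order mem_iota.
Qed.

Lemma time_order_inj : injective time_order.
Proof.
move=> s t eq_st; apply/permP => i; apply: val_inj.
by have := index_time_order s i; rewrite eq_st index_time_order.
Qed.

Lemma sum_permutations (A : zmodType) (F : seq nat -> A) :
  \sum_(l <- permutations (iota 0 r)) F l = \sum_s F (time_order s).
Proof.
rewrite -[RHS](big_map time_order xpredT F); apply: perm_big.
rewrite perm_sym; apply: uniq_perm; rewrite ?permutations_uniq //.
  by rewrite map_inj_uniq ?index_enum_uniq //; apply: time_order_inj.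
apply: (uniq_min_size _ _ _).2.
- by rewrite map_inj_uniq ?index_enum_uniq //; apply: time_order_inj.
- by move=> _ /mapP[s _ ->]; rewrite mem_permutations perm_time_order.
rewrite size_permutations ?iota_uniq // size_iota size_map.
by rewrite -(card_Sn r) cardE enumT.
Qed.

(** Reading the product from left to right reverses s, so that an adjacent
    pair of positions p, p + 1 filled in this order is a descent of s. *)
Lemma succ_after_time_order s : succ_after (time_order s) = descents s.
Proof.
rewrite succ_after_index ?time_order_uniq //.
transitivity (\sum_(j < r) (((rev_ord j).+1 < r) &&
    (s j < index (rev_ord j).+1 (time_order s))))%N.
  rewrite {1}/time_order big_map big_enum (reindex_inj (@perm_inj _ s)).
  by apply: eq_big => // j _; rewrite permK mem_time_order index_time_order.
have pairs (i : 'I_r) : ([exists j : 'I_r, (j == i.+1 :> nat) && (s j < s i)%N]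
  : nat) =
    (\sum_(j < r) ((j == i.+1 :> nat) && (s j < s i)))%N.
  case: existsP => [[j /andP[/eqP def_j lt_ji]]|no_j].
    rewrite (bigD1 j) //= def_j eqxx lt_ji big1 // => k neq_kj.
    by rewrite -def_j [_ == _ :> nat](negPf neq_kj).
  by rewrite big1 // => j _; case: andP => // lt_j; case: no_j; exists j;
    apply/andP.
rewrite /descents -sum1_card [RHS]big_mkcond /=.
rewrite [RHS](eq_bigr (fun i : 'I_r =>
  \sum_(j < r) ((j == i.+1 :> nat) && (s j < s i)))%N); last first.
  by move=> i _; rewrite inE -pairs; case: [exists _, _].
rewrite [RHS]exchange_big /=; apply: eq_bigr => j _.
case: (posnP j) => [j0|j_gt0].
  rewrite big1 => [|i _]; last by rewrite j0.
  by rewrite /= j0 subn1 prednK ?ltnn // -j0 (leq_ltn_trans _ (ltn_ord j)).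
have lt_j1 : (j.-1 < r)%N by rewrite prednK // ltnW.
rewrite (bigD1 (Ordinal lt_j1)) //= prednK // eqxx big1 ?addn0 => [|i neq_i];
  last first.
  case: eqP => // def_j; case/eqP: neq_i; apply: val_inj; rewrite /= def_j //.
have def_rev : (rev_ord j).+1 =
  rev_ord (Ordinal lt_j1) by rewrite /= subnSK ?prednK.
by rewrite def_rev index_time_order ltn_ord.
Qed.

Lemma beta_coef_time_order s : (0 < r)%N ->
  beta_coef (succ_after (time_order s)) (pred_after (time_order s)) =
  (-1) ^+ descents s / r%:R * ('C(r.-1, descents s)%:R)^-1.
Proof.
move=> r_gt0; have := succ_pred_after_iota (perm_time_order s).
rewrite succ_after_time_order; move: (pred_after _) => b def_b.
rewrite /beta_coef def_b prednK //; set a := descents s in def_b *.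
have le_ar : (a <= r.-1)%N by rewrite -def_b leq_addr.
have b_fact : ((r`!%:R : rat) = r%:R * 'C(r.-1, a)%:R * (a`! * b`!)%:R).
  rewrite -!natrM -[r in LHS]prednK // factS prednK // -(bin_fact le_ar) mulnA.
  by rewrite -def_b addKn.
rewrite b_fact; have ab_neq0 : ((a`! * b`!)%:R : rat) != 0.
  by rewrite pnatr_eq0 -lt0n muln_gt0 !fact_gt0.
move: (_`! * _)%:R ab_neq0 => N N_neq0.
have -> : (-1) ^+ a * N / (r%:R * 'C(r.-1, a)%:R * N) =
  (-1) ^+ a / (r%:R * 'C(r.-1, a)%:R).
  by rewrite (invfM _ N) -mulrA [N * _]mulrCA mulfV // mulr1.
by rewrite invfM mulrA.
Qed.

Lemma nth_reorder s u (i : 'I_r) :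
  nth 0%N [seq nth 0%N u p | p <- time_order s] i =
    nth 0%N u (rev_ord (s^-1%g i)).
Proof. by rewrite (nth_map 0%N) ?size_time_order // nth_time_order. Qed.

(** Permuting letters preserves length and weight; this renames the exponents
    of t_1, ..., t_r as the letters of the product. *)
Lemma perm_words s m :
  perm_eq [seq [seq nth 0%N u p | p <- time_order s] | u <- words r m]
    (words r m).
Proof.
have reorder_inj : {in words r m &,
    injective (fun u => [seq nth 0%N u p | p <- time_order s])}.
  move=> u w; rewrite !mem_words => /andP[/eqP sz_u _] /andP[/eqP sz_w _] eq_uw.
  apply: (@eq_from_nth _ 0%N); rewrite sz_u // => p lt_p.
  have := nth_reorder s u (s (rev_ord (Ordinal lt_p))).
  by rewrite eq_uw nth_reorder permK rev_ordK.
have reorder_uniq : uniq [seq [seq nth 0%N u p | p <- time_order s] | u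
  <- words r m].
  by rewrite map_inj_in_uniq ?words_uniq.
apply: uniq_perm; rewrite ?words_uniq //; apply: (uniq_min_size _ _ _).2 => //.
  move=> _ /mapP[u Wu ->]; move: Wu;
    rewrite !mem_words size_map size_time_order eqxx.
  case/andP=> /eqP sz_u /eqP <-; apply/eqP; apply: perm_weight.
  by rewrite -{2}(mkseq_nth 0%N u) sz_u; apply: perm_map;
    apply: perm_time_order.
by rewrite size_map.
Qed.

End TimeOrder.

(** * The expansion of the logarithm *)

Section LogExpansion.
Variables (K : comAlgType rat) (v : var_kind) (n : nat).
Local Notation Kz := (zseries v n K).
Local Notation q := (@qop K Kz).
Variable h : tseries (linop Kz).

Definition descent_coef r (s : {perm 'I_r}) : rat :=
  (-1) ^+ descents s / r%:R * ('C(r.-1, descents s)%:R)^-1.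

(** The integrand of order r, with the parameter t at index 0 and t_1, ...,
    t_r at the indices 1, ..., r. *)
Definition ordered_integrand r : pseries r.+1 (linop Kz) :=
  \sum_(s : {perm 'I_r}) q (descent_coef s) *:
    \prod_(j < r) at_param (lift ord0 (s (rev_ord j))) h.

Arguments ordered_integrand : clear implicits.

Lemma integrand_coef r (k : {cmonom 'I_r.+1}) :
  ordered_integrand r k = if k ord0 == 0%N then
    \sum_(s : {perm 'I_r}) q (descent_coef s) *
      \prod_(j < r) h (k (lift ord0 (s (rev_ord j)))) else 0.
Proof.
have coef_s (s : {perm 'I_r}) :
  (\prod_(j < r) at_param (lift ord0 (s (rev_ord j))) h) k =
    if k ord0 == 0%N then \prod_(j < r) h (k (lift ord0 (s (rev_ord j)))) else
      0.
  pose J := [seq lift ord0 (s (rev_ord j)) | j <- index_enum 'I_r].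
  have prodJ (B : pzRingType) (g : 'I_r.+1 -> B) :
      \prod_(j <- J) g j = \prod_(j < r) g (lift ord0 (s (rev_ord j))).
    by rewrite /J big_map.
  rewrite -(prodJ _ (fun j => at_param j h)) prod_at_param ?prodJ; last first.
    rewrite map_inj_uniq ?index_enum_uniq // => i j /lift_inj eq_ij.
    exact: rev_ord_inj (perm_inj eq_ij).
  congr (if _ then _ else _); apply/forallP/idP => [k0|/eqP k0 i].
    apply: (implyP (k0 ord0)); apply/negP => /mapP[j _ /eqP].
    by rewrite (negPf (neq_lift _ _)).
  apply/implyP; case: (unliftP ord0 i) => [i'|] ->; last by rewrite k0.
  case/negP; apply/mapP; exists (rev_ord (s^-1%g i'));
    first exact: mem_index_enum.
  by rewrite rev_ordK permKV.
rewrite /ordered_integrand series_sumE; case: ifP => [k0|k_neq0].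
  by apply: eq_bigr => s _; rewrite series_scaleE coef_s k0.
by rewrite big1 // => s _; rewrite series_scaleE coef_s k_neq0 mulr0.
Qed.

(** Exchange the sums over exponents and permutations, and rename the
    exponents in each permuted product so that the product of operators no
    longer depends on the permutation. *)
Lemma iterated_integral_words r m : (0 < r)%N ->
  iterated_integral (ordered_integrand r) m =
  \sum_(w <- words r m) q (log_sum m.+1 (flow_series - 1) (FMonom w)) *
    \prod_(k <- w) h k.
Proof.
move=> r_gt0; rewrite iterated_integralE => [|k k_neq0]; last first.
  by rewrite integrand_coef (negPf k_neq0).
transitivity (\sum_(s : {perm 'I_r}) \sum_(w <- words r m)
  q (simplex_coef w * descent_coef s) * \prod_(j < r) h
    (nth 0%N w (s (rev_ord j)))).
  rewrite exchange_big /=; apply: eq_bigr => w _.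
  rewrite integrand_coef expvecE eqxx mulr_sumr; apply: eq_bigr => s _.
  rewrite [q (simplex_coef w * _)]rmorphM -mulrA; congr (_ * (_ * _)).
  by apply: eq_bigr => j _; rewrite expvecE lift0.
transitivity (\sum_(w <- words r m) \sum_(s : {perm 'I_r})
  q (simplex_coef [seq nth 0%N w p | p <- time_order s] * descent_coef s) *
  \prod_(k <- w) h k).
  rewrite [RHS]exchange_big /=; apply: eq_bigr => s _.
  rewrite -(perm_big _ (perm_words s m)) big_map; apply: eq_big_seq => w.
  rewrite mem_words => /andP[/eqP sz_w _]; congr (_ * _).
  rewrite (big_nth 0%N) sz_w big_mkord; apply: eq_bigr => j _.
  by rewrite nth_reorder permK rev_ordK.
apply: eq_big_seq => w; rewrite mem_words => /andP[/eqP sz_w /eqP wt_w].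
rewrite -mulr_suml -rmorph_sum /=; congr (q _ * _).
rewrite log_flow_series;
  last by rewrite sz_w r_gt0 -wt_w ltnS -sz_w size_le_weight.
rewrite sz_w sum_permutations; apply: eq_bigr => s _.
by rewrite beta_coef_time_order.
Qed.

End LogExpansion.

Arguments ordered_integrand {K v n} h r.

Theorem theorem5p2 (K : comAlgType rat) (v : var_kind) (n alpha : nat)
    (F G : {lrmorphism zseries v n (tseries K) -> zseries v n (tseries K)})
    (d h : tseries (linop (zseries v n K))) :
  (1 <= alpha)%N ->
  (* F_t, with inverse G_t = z + M_t *)
  in_At alpha F -> cancel F G -> cancel G F ->
  (* d(t) *)
  over_diffop alpha d -> d 0%N = 0 ->
  (forall u, tact (texp d) u = G u) ->
  (* h(t) is the derivation sending z_i to dM_t/dt(F_t) *)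
  over_diffop alpha h -> derivation (tact h) ->
  (forall i, tact h (zX v (tseries K) i) =
     F (tderiv (G (zX v (tseries K) i) - zX v (tseries K) i))) ->
  is_tsum
    (fun r => iterated_integral
       (\sum_(s : {perm 'I_r})
          qop (zseries v n K)
            ((-1) ^+ descents s / r%:R * ('C(r.-1, descents s)%:R)^-1) *:
          \prod_(j < r) at_param (lift ord0 (s (rev_ord j))) h))
    d.
Proof.
move=> _ _ FK GK _ d0 act_d _ h_der act_h m.
have flow := flow_equation GK FK act_d h_der act_h.
have d_words : d m = \sum_(1 <= r < m.+1) iterated_integral
  (ordered_integrand h r) m.
  rewrite log_texp // (texp_flow flow) -[X in (_ - X)](ev1 h) -evN -evD.
  transitivity (ev h (log_sum m.+1 (flow_series - 1)) m).
    rewrite /log_sum ev_sum !series_sumE; apply: eq_bigr => k _.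
    by rewrite evZ evX.
  rewrite /ev sum_all_words -(big_mkord xpredT (fun r => \sum_(w <- words r m)
    qop _ (log_sum m.+1 (flow_series - 1) (FMonom w)) * \prod_(k <- w) h k)).
  rewrite big_ltn // [X in X + _](_ : _ = 0) ?add0r.
    by apply: eq_big_nat => r /andP[r_gt0 _]; rewrite iterated_integral_words.
  (* Only the empty word has length 0, and its logarithm has no constant
     term. *)
  rewrite /=; case: m => [|m]; last by rewrite big_nil.
  by rewrite big_seq1 /log_sum big_ord1 logc0 scale0r rmorph0 mul0r.
(* A word of weight m has at most m letters, so that the integrals of order r
   > m have no term in t^m. *)
exists m.+1 => N le_mN; rewrite series_sumE d_words (big_cat_nat _ le_mN) //=.
rewrite [X in _ + X]big_nat_cond [X in _ + X]big1 ?addr0 // =>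
  r /andP[/andP[lt_mr _] _].
rewrite -/(ordered_integrand h r) iterated_integral_words
  ?(leq_ltn_trans _ lt_mr) //.
rewrite big_seq big1 // => w; rewrite mem_words => /andP[/eqP sz_w /eqP wt_w].
by have := size_le_weight w; rewrite sz_w wt_w leqNgt lt_mr.
Qed.
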